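(* Let $M$ be a complex affine variety with algebra of functions $A$, let $\mathfrak g=sl_{r+1}$ with vector representation $V_{r+1}$ and first fundamental weight $\omega_1$, and let $\{\mathcal Z\}_{n\omega_1}=(\mathcal Z_1,\dots,\mathcal Z_n)$ be any $n\omega_1$-multiset of points of $M$ ($n\ge 0$). Then there is a natural isomorphism of $sl_{r+1}\otimes A$-modules $$W_M(\{\mathcal Z\}_{n\omega_1})\cong S^n(V_{r+1}\otimes A)\big/ J\cdot S^n(V_{r+1}\otimes A),$$ where $W_M(\{\mathcal Z\}_{n\omega_1})$ is the local Weyl module and $J=\{R\in S^n(A)\mid R(\mathcal Z_1,\dots,\mathcal Z_n)=0\}$.
   Context: All vector spaces and algebras are over $\mathbb C$; $M$ may be singular. For $\mathfrak g=sl_{r+1}$ ($r\ge1$) let $\mathfrak h$ be the Cartan subalgebra, $\mathfrak n_+$ the positive nilpotent subalgebra, $h_1,\dots,h_r$ the simple coroots, $P\subset\mathfrak h^*$ the weight lattice; $\omega_1(h_1)=1$ and $\omega_1(h_i)=0$ for $i>1$. A $\mathfrak g$-module $V$ is integrable if there is a finite subset $D\subset P$ with $V=\bigoplus_{\mu\in D}V^\mu$, where each $h\in\mathfrak h$ acts on $V^\mu$ by the scalar $\mu(h)$ (the spaces $V^\mu$ may be infinite-dimensional). A $\mathfrak g\otimes A$-module is $\mathfrak g\otimes1$-integrable if it is integrable over $\mathfrak g\cong\mathfrak g\otimes 1$. The bracket on $\mathfrak g\otimes A$ is $[x\otimes P,y\otimes Q]=[x,y]\otimes PQ$. An $n\omega_1$-multiset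 is a family of $n$ points $\mathcal Z_1,\dots,\mathcal Z_n\in M$, not necessarily distinct. The local Weyl module $W_M(\{\mathcal Z\}_{n\omega_1})$ is the maximal $\mathfrak g\otimes1$-integrable $\mathfrak g\otimes A$-module generated by a vector $v_{\{\mathcal Z\}}$ such that for all $P\in A$: $(\mathfrak n_+\otimes P)v_{\{\mathcal Z\}}=0$, $(h_1\otimes P)v_{\{\mathcal Z\}}=\sum_{j=1}^nP(\mathcal Z_j)\,v_{\{\mathcal Z\}}$, and $(h_i\otimes P)v_{\{\mathcal Z\}}=0$ for $i>1$. ''Maximal'' means that any other such module is a quotient of it (generator mapping to generator). $sl_{r+1}\otimes A$ acts on $V_{r+1}\otimes A$ by $(g\otimes P)(w\otimes Q)=gw\otimes PQ$ and on the $n$-th symmetric power $S^n(V_{r+1}\otimes A)$ (over $\mathbb C$) by the induced action. The algebra $S^n(A)=(A^{\otimes n})^{\Sigma_n}$ (symmetric functions on $M^n$) acts on $S^n(V_{r+1}\otimes A)$, regarded as the $\Sigma_n$-invariants in $(V_{r+1}\otimes A)^{\otimes n}\cong V_{r+1}^{\otimes n}\otimes A^{\otimes n}$, by multiplication in $A^{\otimes n}$; this action commutes with that of $sl_{r+1}\otimes A$. The natural map sends $v_{\{\mathcal Z\}}$ to the image of the $n$-th symmetric power of $v\otimes1$, where $v$ is the highest weight vector of $V_{r+1}$. *)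

(* Defs.v *)
From HB Require Import structures.
From mathcomp Require Import all_boot all_fingroup all_algebra generic_quotient.
From mathcomp Require Import freeg mpoly.
From mathcomp Require Import boolp.

Set Implicit Arguments.
Unset Strict Implicit.
Unset Printing Implicit Defensive.

Import GRing.Theory.
Local Open Scope ring_scope.
Local Open Scope quotient_scope.

Section Linear.
Variables (K : fieldType) (V W : lmodType K) (f : V -> W) (lf : linear f).

Lemma lin0 : f 0 = 0.
Proof. by rewrite -[X in f X](addNr 0) -scaleN1r lf scaleN1r addNr. Qed.

Lemma linD u v : f (u + v) = f u + f v.
Proof. by rewrite -[u]scale1r lf !scale1r. Qed.

Lemma linZ a u : f (a *: u) = a *: f u.
Proof. by rewrite -[X in f X]addr0 lf lin0 addr0. Qed.

Lemma linB u v : f (u - v) = f u - f v.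
Proof. by rewrite linD -scaleN1r linZ scaleN1r. Qed.

Lemma lin_sum (I : Type) (r : seq I) (P : pred I) (F : I -> V) :
  f (\sum_(i <- r | P i) F i) = \sum_(i <- r | P i) f (F i).
Proof. by elim/big_rec2: _ => [|i y z _ <-]; [apply: lin0 | apply: linD]. Qed.
End Linear.

Section Quotient.
Variables (K : fieldType) (V : lmodType K) (S : V -> Prop).

Inductive span : V -> Prop :=
| span0 : span 0
| spanS a u v : S u -> span v -> span (a *: u + v).

Lemma span_gen u : S u -> span u.
Proof. by move=> Su; rewrite -[u]addr0 -[u]scale1r; apply: spanS span0. Qed.

Lemma spanD u v : span u -> span v -> span (u + v).
Proof.
move=> su sv; elim: su => [|a x y Sx _ IH]; first by rewrite add0r.
by rewrite -addrA; apply: spanS.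
Qed.

Lemma spanZ a u : span u -> span (a *: u).
Proof.
elim=> [|b x y Sx _ IH]; first by rewrite scaler0; apply: span0.
by rewrite scalerDr scalerA; apply: spanS.
Qed.

Definition in_span : {pred V} := fun u => `[< span u >].

Lemma in_spanP u : reflect (span u) (u \in in_span).
Proof. exact: asboolP. Qed.

Lemma in_span_zmod : zmod_closed in_span.
Proof.
split=> [|u v /in_spanP su /in_spanP sv]; first exact/in_spanP/span0.
by apply/in_spanP; rewrite -scaleN1r; apply: spanD => //; apply: spanZ.
Qed.

HB.instance Definition _ := GRing.isZmodClosed.Build V in_span in_span_zmod.

(* The quotient of V by the subspace spanned by S. *)
Definition lquot := Quotient.quot in_span.
HB.instance Definition _ := GRing.Zmodule.on lquot.

Definition proj (u : V) : lquot := \pi_(Quotient.quot in_span) u.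

Lemma eq_proj u v : proj u = proj v <-> span (u - v).
Proof.
split=> [/eqP|].
  by rewrite /proj -Quotient.idealrBE => /in_spanP.
by move=> /in_spanP; rewrite Quotient.idealrBE => /eqP.
Qed.

Definition qrepr (q : lquot) : V := repr (q : Quotient.quot in_span).

Lemma qreprK q : proj (qrepr q) = q.
Proof. exact: reprK. Qed.

Lemma projD u v : proj (u + v) = proj u + proj v.
Proof. exact: raddfD. Qed.

Lemma qrepr_proj u : span (qrepr (proj u) - u).
Proof. by apply/eq_proj; rewrite qreprK. Qed.

Definition qscale (a : K) (q : lquot) : lquot := proj (a *: qrepr q).

Lemma qscale_proj a u : qscale a (proj u) = proj (a *: u).
Proof. by apply/eq_proj; rewrite -scalerBr; apply/spanZ/qrepr_proj. Qed.

Lemma qscaleA a b q : qscale a (qscale b q) = qscale (a * b) q.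
Proof. by rewrite -[q]qreprK !qscale_proj scalerA. Qed.

Lemma qscale1 : left_id 1 qscale.
Proof. by move=> q; rewrite -[q]qreprK qscale_proj scale1r. Qed.

Lemma qscaleDr : right_distributive qscale +%R.
Proof.
by move=> a q p; rewrite -[q]qreprK -[p]qreprK -projD !qscale_proj scalerDr projD.
Qed.

Lemma qscaleDl q : {morph qscale^~ q : a b / a + b}.
Proof. by move=> a b; rewrite -[q]qreprK !qscale_proj scalerDl projD. Qed.

HB.instance Definition _ := GRing.Zmodule_isLmodule.Build K lquot
  qscaleA qscale1 qscaleDr qscaleDl.

Lemma projZ a u : proj (a *: u) = a *: proj u.
Proof. by rewrite -qscale_proj. Qed.

Lemma proj_linear : linear proj.
Proof. by move=> a u v; rewrite projD projZ. Qed.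

HB.instance Definition _ := GRing.isLinear.Build K V lquot _ proj proj_linear.

Lemma proj0P u : proj u = 0 <-> span u.
Proof. by rewrite -(raddf0 proj) eq_proj subr0. Qed.

(* The map induced by f; only meaningful for f linear and vanishing on S,
   see qliftE. *)
Definition qlift (W : lmodType K) (f : V -> W) (q : lquot) : W := f (qrepr q).

Lemma qliftE (W : lmodType K) (f : V -> W) : linear f ->
  (forall u, S u -> f u = 0) -> forall u, qlift f (proj u) = f u.
Proof.
move=> lf f0 u.
apply/eqP; rewrite -subr_eq0 /qlift -(linB lf); apply/eqP.
elim: (qrepr_proj u) => [|a x y Sx _ IH]; first exact: lin0.
by rewrite lf IH addr0 f0 // scaler0.
Qed.

Lemma qlift_linear (W : lmodType K) (f : V -> W) : linear f ->
  (forall u, S u -> f u = 0) -> linear (qlift f).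
Proof.
move=> lf f0 a p q.
by rewrite -[p]qreprK -[q]qreprK -projZ -projD !qliftE // lf.
Qed.

End Quotient.

Section FreeModule.
Variables (K : fieldType) (X : choiceType).

Definition fgen (x : X) : {freeg X / K} := << x >>.

Lemma freeg_lin_ind (P : {freeg X / K} -> Prop) :
  P 0 -> (forall a x D, P D -> P (a *: fgen x + D)) -> forall D, P D.
Proof.
move=> P0 PS D; rewrite -[D]freeg_sumE.
elim: (dom D) => [|x s IH]; first by rewrite big_nil.
rewrite big_cons (_ : << coeff x D *g x >> = coeff x D *: fgen x); first exact: PS.
by apply/eqP/freeg_eqP => y; rewrite coeffZ !coeffU mul1r.
Qed.

Variable W : lmodType K.

Lemma fglift_gen (f : X -> W) x : fglift f (fgen x) = f x.
Proof. by rewrite liftU scale1r. Qed.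

Lemma fgliftD (f : X -> W) : {morph fglift f : D1 D2 / D1 + D2}.
Proof.
have FB := @lift_is_additive K X W f; move=> D1 D2.
have FN D : fglift f (- D) = - fglift f D.
  by rewrite -[- D]sub0r FB -{1}(subrr 0) FB subrr sub0r.
by rewrite -{1}[D2]opprK FB FN opprK.
Qed.

Lemma fglift0 (f : X -> W) : fglift f 0 = 0.
Proof. by rewrite -(subrr 0) lift_is_additive subrr. Qed.

Lemma fglift_sum (f : X -> W) (D : {freeg X / K}) :
  fglift f D = \sum_(x <- dom D) coeff x D *: f x.
Proof.
rewrite -{1}[D]freeg_sumE; elim: (dom D) => [|x s IH].
  by rewrite !big_nil fglift0.
by rewrite !big_cons fgliftD IH liftU.
Qed.

Lemma fglift_linear (f : X -> W) : linear (fglift f).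
Proof.
move=> a D E; rewrite fgliftD; congr (_ + _).
elim/freeg_lin_ind: D => [|b x D IH]; first by rewrite scaler0 fglift0 scaler0.
have U c : fglift f (c *: fgen x) = c *: f x.
  rewrite (_ : c *: _ = << c *g x >>) ?liftU //.
  by apply/eqP/freeg_eqP => y; rewrite coeffZ !coeffU mul1r.
by rewrite scalerDr scalerA !fgliftD IH !U scalerDr scalerA.
Qed.

Lemma fglift_lin (f g : X -> W) a (D : {freeg X / K}) :
  fglift (fun x => a *: f x + g x) D = a *: fglift f D + fglift g D.
Proof.
rewrite !fglift_sum scaler_sumr -big_split /=; apply: eq_bigr => x _.
by rewrite scalerDr !scalerA mulrC.
Qed.

End FreeModule.

Section Tensor.
Variables (K : fieldType) (U V : lmodType K).

Inductive tens_rel : {freeg (U * V) / K} -> Prop :=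
| tens_rel_l a u u' v :
    tens_rel (fgen K (a *: u + u', v) - a *: fgen K (u, v) - fgen K (u', v))
| tens_rel_r a u v v' :
    tens_rel (fgen K (u, a *: v + v') - a *: fgen K (u, v) - fgen K (u, v')).

Definition tens := lquot tens_rel.
HB.instance Definition _ := GRing.Lmodule.on tens.

Definition ptens (u : U) (v : V) : tens := proj tens_rel (fgen K (u, v)).

Lemma ptens_linl v : linear (ptens^~ v).
Proof.
move=> a u u'; apply/eqP; rewrite /ptens -projZ -projD -subr_eq0.
rewrite -raddfB; apply/eqP/proj0P; rewrite opprD addrA.
exact/span_gen/tens_rel_l.
Qed.

Lemma ptens_linr u : linear (ptens u).
Proof.
move=> a v v'; apply/eqP; rewrite /ptens -projZ -projD -subr_eq0.
rewrite -raddfB; apply/eqP/proj0P; rewrite opprD addrA.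
exact/span_gen/tens_rel_r.
Qed.

Lemma tens_ind (P : tens -> Prop) :
  P 0 -> (forall a u v t, P t -> P (a *: ptens u v + t)) -> forall t, P t.
Proof.
move=> P0 PS t; rewrite -[t]qreprK.
elim/freeg_lin_ind: (qrepr t) => [|a [u v] D IH]; first by rewrite raddf0.
by rewrite projD projZ; apply: PS.
Qed.

Definition bilin (W : lmodType K) (f : U -> V -> W) :=
  (forall v, linear (f^~ v)) /\ (forall u, linear (f u)).

(* The linear map induced by a bilinear map f, see tens_liftE. *)
Definition tens_lift (W : lmodType K) (f : U -> V -> W) : tens -> W :=
  qlift (fglift (fun p : U * V => f p.1 p.2)).

Lemma tens_lift_rel (W : lmodType K) (f : U -> V -> W) : bilin f ->
  forall D, tens_rel D -> fglift (fun p : U * V => f p.1 p.2) D = 0.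
Proof.
move=> [fl fr] D; set F := fglift _.
have [FB FZ] := (linB (fglift_linear _) : {morph F : x y / x - y},
                 linZ (fglift_linear _) : forall a, {morph F : x / a *: x}).
by case=> *; rewrite !FB FZ /F !fglift_gen /= ?fl ?fr addrAC addrK subrr.
Qed.

Lemma tens_liftE (W : lmodType K) (f : U -> V -> W) : bilin f ->
  forall u v, tens_lift f (ptens u v) = f u v.
Proof.
move=> bf u v; rewrite /tens_lift /ptens qliftE ?fglift_gen //.
  exact: fglift_linear.
exact: tens_lift_rel.
Qed.

Lemma tens_lift_linear (W : lmodType K) (f : U -> V -> W) : bilin f ->
  linear (tens_lift f).
Proof.
by move=> bf; apply: qlift_linear; [apply: fglift_linear | apply: tens_lift_rel].
Qed.

Lemma tens_lift_lin (W : lmodType K) (f g h : U -> V -> W) a t :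
  (forall u v, h u v = a *: f u v + g u v) ->
  tens_lift h t = a *: tens_lift f t + tens_lift g t.
Proof.
move=> E; rewrite /tens_lift /qlift -fglift_lin.
by congr fglift; apply/funext => p; apply: E.
Qed.

End Tensor.

Section TensorPower.
Variables (K : fieldType) (n : nat).

Definition upd (T : Type) (f : {ffun 'I_n -> T}) (i : 'I_n) (x : T) :
  {ffun 'I_n -> T} := [ffun j => if j == i then x else f j].

Lemma updC T (f : {ffun 'I_n -> T}) i j x y : i != j ->
  upd (upd f i x) j y = upd (upd f j y) i x.
Proof.
move=> ij; apply/ffunP => k; rewrite !ffunE.
case: (eqVneq k j) => // kj; case: (eqVneq k i) => // ki.
by rewrite -kj -ki eqxx in ij.
Qed.

Lemma upd_upd T (f : {ffun 'I_n -> T}) i x y : upd (upd f i x) i y = upd f i y.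
Proof. by apply/ffunP => k; rewrite !ffunE; case: eqP. Qed.

Variable V : lmodType K.

Inductive tpow_rel : {freeg {ffun 'I_n -> V} / K} -> Prop :=
| TpowRel f i a u v :
    tpow_rel (fgen K (upd f i (a *: u + v)) - a *: fgen K (upd f i u)
              - fgen K (upd f i v)).

Definition tpow := lquot tpow_rel.
HB.instance Definition _ := GRing.Lmodule.on tpow.

Definition ptpow (f : {ffun 'I_n -> V}) : tpow := proj tpow_rel (fgen K f).

Definition multilin (W : lmodType K) (phi : {ffun 'I_n -> V} -> W) :=
  forall f i, linear (fun u => phi (upd f i u)).

Lemma ptpow_multilin : multilin ptpow.
Proof.
move=> f i a u v; apply/eqP; rewrite /ptpow -projZ -projD -subr_eq0.
rewrite -raddfB; apply/eqP/proj0P; rewrite opprD addrA.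
exact/span_gen/TpowRel.
Qed.

Lemma tpow_ind (P : tpow -> Prop) :
  P 0 -> (forall a f t, P t -> P (a *: ptpow f + t)) -> forall t, P t.
Proof.
move=> P0 PS t; rewrite -[t]qreprK.
elim/freeg_lin_ind: (qrepr t) => [|a f D IH]; first by rewrite raddf0.
by rewrite projD projZ; apply: PS.
Qed.

(* The linear map induced by a multilinear map phi, see tpow_liftE. *)
Definition tpow_lift (W : lmodType K) (phi : {ffun 'I_n -> V} -> W) : tpow -> W :=
  qlift (fglift phi).

Lemma tpow_lift_rel (W : lmodType K) (phi : {ffun 'I_n -> V} -> W) :
  multilin phi -> forall D, tpow_rel D -> fglift phi D = 0.
Proof.
move=> mphi D; set F := fglift _.
have [FB FZ] := (linB (fglift_linear _) : {morph F : x y / x - y},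
                 linZ (fglift_linear _) : forall a, {morph F : x / a *: x}).
by case=> f i a u v; rewrite !FB FZ /F !fglift_gen mphi addrAC addrK subrr.
Qed.

Lemma tpow_liftE (W : lmodType K) (phi : {ffun 'I_n -> V} -> W) :
  multilin phi -> forall f, tpow_lift phi (ptpow f) = phi f.
Proof.
move=> mphi f; rewrite /tpow_lift /ptpow qliftE ?fglift_gen //.
  exact: fglift_linear.
exact: tpow_lift_rel.
Qed.

Lemma tpow_lift_linear (W : lmodType K) (phi : {ffun 'I_n -> V} -> W) :
  multilin phi -> linear (tpow_lift phi).
Proof.
by move=> mphi; apply: qlift_linear; [apply: fglift_linear | apply: tpow_lift_rel].
Qed.

Lemma tpow_lift_lin (W : lmodType K) (f g h : {ffun 'I_n -> V} -> W) a t :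
  (forall x, h x = a *: f x + g x) ->
  tpow_lift h t = a *: tpow_lift f t + tpow_lift g t.
Proof.
move=> E; rewrite /tpow_lift /qlift -fglift_lin.
by congr fglift; apply/funext => p; apply: E.
Qed.

Lemma tpow_eq (W : lmodType K) (f g : tpow -> W) : linear f -> linear g ->
  (forall x, f (ptpow x) = g (ptpow x)) -> f =1 g.
Proof.
move=> lf lg E t.
elim/tpow_ind: t => [|a x t IH]; first by rewrite !lin0.
by rewrite lf lg IH E.
Qed.

Definition tshuffle (s : 'S_n) : tpow -> tpow :=
  tpow_lift (fun f => ptpow [ffun i => f (s i)]).

Lemma tshuffle_multilin (s : 'S_n) :
  multilin (fun f : {ffun 'I_n -> V} => ptpow [ffun i => f (s i)]).
Proof.
move=> f i a u v.
have E x : [ffun k => upd f i x (s k)] = upd [ffun k => f (s k)] (s^-1%g i) x.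
  by apply/ffunP => k; rewrite !ffunE (canF_eq (permK s)).
by rewrite !E ptpow_multilin.
Qed.

Lemma tshuffleE s f : tshuffle s (ptpow f) = ptpow [ffun i => f (s i)].
Proof. exact/tpow_liftE/tshuffle_multilin. Qed.

Lemma tshuffle_linear s : linear (tshuffle s).
Proof. exact/tpow_lift_linear/tshuffle_multilin. Qed.

Definition symmetric_tensor : {pred tpow} :=
  fun t => [forall s : 'S_n, tshuffle s t == t].

Lemma symmetric_tensorP t :
  reflect (forall s, tshuffle s t = t) (t \in symmetric_tensor).
Proof. exact: 'forall_eqP. Qed.

Lemma symmetric_tensor_submod : submod_closed symmetric_tensor.
Proof.
split=> [|a t u /symmetric_tensorP Ht /symmetric_tensorP Hu].
  apply/symmetric_tensorP => s.
  exact/lin0/tshuffle_linear.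
by apply/symmetric_tensorP => s; rewrite tshuffle_linear Ht Hu.
Qed.

HB.instance Definition _ :=
  GRing.isSubmodClosed.Build K tpow symmetric_tensor symmetric_tensor_submod.

(* The n-th symmetric power, as the symmetric-group invariants in the n-th
   tensor power. *)
Record sympow := Sympow { symval :> tpow; symvalP : symmetric_tensor symval }.

HB.instance Definition _ := [isSub for symval].
HB.instance Definition _ := [Choice of sympow by <:].
HB.instance Definition _ := [SubChoice_isSubLmodule of sympow by <:].

Lemma sympow_fix (t : sympow) s : tshuffle s t = t.
Proof. by apply: symmetric_tensorP; apply: symvalP. Qed.

Lemma ptpow_const_sym v : symmetric_tensor (ptpow [ffun=> v]).
Proof.
apply/symmetric_tensorP => s; rewrite tshuffleE; congr ptpow.
by apply/ffunP => i; rewrite !ffunE.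
Qed.

Definition symconst (v : V) : sympow := Sympow (ptpow_const_sym v).

End TensorPower.

Section TensorPowerMaps.
Variables (K : fieldType) (n : nat).

(* The derivation of the tensor power induced by an operator D:
   v_1 ... v_n |-> sum_i v_1 ... (D v_i) ... v_n. *)
Definition tderiv (V : lmodType K) (D : V -> V) : tpow n V -> tpow n V :=
  tpow_lift (fun f => \sum_(i < n) ptpow (upd f i (D (f i)))).

Lemma tderiv_multilin (V : lmodType K) (D : V -> V) : linear D ->
  multilin (fun f : {ffun 'I_n -> V} => \sum_(i < n) ptpow (upd f i (D (f i)))).
Proof.
move=> lD f i a u v; rewrite scaler_sumr -big_split /=; apply: eq_bigr => j _.
case: (eqVneq j i) => [->|ji].
  by rewrite !upd_upd !ffunE eqxx lD ptpow_multilin.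
by rewrite !ffunE (negbTE ji) !(updC _ _ _ (_ : i != j)) 1?eq_sym // ptpow_multilin.
Qed.

Lemma tderivE (V : lmodType K) (D : V -> V) f : linear D ->
  tderiv D (ptpow f) = \sum_(i < n) ptpow (upd f i (D (f i))).
Proof. by move=> lD; rewrite /tderiv tpow_liftE //; apply: tderiv_multilin. Qed.

Lemma tderiv_linear (V : lmodType K) (D : V -> V) : linear D -> linear (tderiv D).
Proof. by move=> lD; apply/tpow_lift_linear/tderiv_multilin. Qed.

Lemma tderiv_lin (V : lmodType K) (D E F : V -> V) a :
  linear D -> linear E -> linear F -> (forall v, F v = a *: D v + E v) ->
  forall t, tderiv F t = a *: tderiv D t + tderiv E t.
Proof.
move=> lD lE lF FE; apply: tpow_eq; first exact: tderiv_linear.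
  by move=> b t u; rewrite !tderiv_linear // !scalerDr !scalerA mulrC addrACA.
move=> f; rewrite !tderivE // scaler_sumr -big_split /=; apply: eq_bigr => i _.
by rewrite FE ptpow_multilin.
Qed.

Lemma tderiv_comm (V : lmodType K) (D E F : V -> V) :
  linear D -> linear E -> linear F -> (forall v, F v = D (E v) - E (D v)) ->
  forall t, tderiv F t = tderiv D (tderiv E t) - tderiv E (tderiv D t).
Proof.
move=> lD lE lF FE; apply: tpow_eq; first exact: tderiv_linear.
  move=> b t u; rewrite !tderiv_linear //.
  by rewrite scalerBr opprD addrACA.
move=> f; rewrite !tderivE // !(lin_sum (tderiv_linear _)) //.
have H (A B : V -> V) : linear A -> linear B ->
    \sum_(i < n) tderiv A (ptpow (upd f i (B (f i)))) =
    \sum_(i < n) ptpow (upd f i (A (B (f i)))) +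
    \sum_(i < n) \sum_(j < n | j != i)
       ptpow (upd (upd f i (B (f i))) j (A (f j))).
  move=> lA lB; rewrite -big_split /=; apply: eq_bigr => i _.
  rewrite tderivE // (bigD1 i) //= upd_upd !ffunE eqxx; congr (_ + _).
  by apply: eq_bigr => j ji; rewrite !ffunE (negbTE ji).
rewrite !H // [X in _ = _ - (_ + X)](exchange_big_dep predT) //=.
rewrite [X in _ = _ + X - _](_ : _ = \sum_(j < n) \sum_(i < n | j != i)
    ptpow (upd (upd f i (D (f i))) j (E (f j)))); last first.
  apply: eq_bigr => i _; apply: eq_big => j; first by rewrite eq_sym.
  by move=> ji; rewrite updC // eq_sym.
rewrite opprD addrACA subrr addr0 -sumrB; apply: eq_bigr => i _.
by rewrite FE -scaleN1r addrC ptpow_multilin scaleN1r addrC.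
Qed.

Lemma tderiv_shuffle (V : lmodType K) (D : V -> V) s : linear D ->
  forall t, tshuffle s (tderiv D t) = tderiv D (tshuffle s t).
Proof.
move=> lD; apply: tpow_eq.
- by move=> a t u; rewrite tderiv_linear // tshuffle_linear.
- by move=> a t u; rewrite tshuffle_linear tderiv_linear.
move=> f; rewrite tshuffleE !tderivE // (lin_sum (tshuffle_linear s)).
rewrite (reindex_perm s) /=; apply: eq_bigr => i _; rewrite tshuffleE.
congr ptpow; apply/ffunP => k; rewrite !ffunE (inj_eq perm_inj).
by [].
Qed.

(* The bilinear map of tensor powers induced factorwise by a bilinear map. *)
Definition tmap2 (U V W : lmodType K) (m : U -> V -> W)
    (R : tpow n U) (t : tpow n V) : tpow n W :=
  tpow_lift (fun a => tpow_lift (fun f => ptpow [ffun i => m (a i) (f i)]) t) R.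

Section Tmap2.
Variables (U V W : lmodType K) (m : U -> V -> W) (bm : bilin m).

Lemma tmap2_multilin_r (a : {ffun 'I_n -> U}) :
  multilin (fun f : {ffun 'I_n -> V} => ptpow [ffun i => m (a i) (f i)]).
Proof.
move=> f i b u v.
have E x : [ffun k => m (a k) (upd f i x k)] =
           upd [ffun k => m (a k) (f k)] i (m (a i) x).
  by apply/ffunP => k; rewrite !ffunE; case: eqP => // ->.
by rewrite !E bm.2 ptpow_multilin.
Qed.

Lemma tmap2_multilin_l (t : tpow n V) :
  multilin (fun a : {ffun 'I_n -> U} =>
              tpow_lift (fun f => ptpow [ffun i => m (a i) (f i)]) t).
Proof.
move=> a i b u v /=; apply: tpow_lift_lin => f.
have E x : [ffun k => m (upd a i x k) (f k)] =
           upd [ffun k => m (a k) (f k)] i (m x (f i)).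
  by apply/ffunP => k; rewrite !ffunE; case: eqP => // ->.
by rewrite !E bm.1 ptpow_multilin.
Qed.

Lemma tmap2E a f : tmap2 m (ptpow a) (ptpow f) = ptpow [ffun i => m (a i) (f i)].
Proof.
rewrite /tmap2 tpow_liftE; last exact: tmap2_multilin_l.
by rewrite tpow_liftE //; apply: tmap2_multilin_r.
Qed.

Lemma tmap2_linl t : linear ((tmap2 m)^~ t).
Proof. exact/tpow_lift_linear/tmap2_multilin_l. Qed.

Lemma tmap2_linr R : linear (tmap2 m R).
Proof.
move=> a t u; apply: tpow_lift_lin => f.
by rewrite (tpow_lift_linear (tmap2_multilin_r f)).
Qed.

Lemma tmap2_shuffle s R t :
  tshuffle s (tmap2 m R t) = tmap2 m (tshuffle s R) (tshuffle s t).
Proof.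
pose L t := fun R => tshuffle s (tmap2 m R t).
pose G t := fun R => tmap2 m (tshuffle s R) (tshuffle s t).
rewrite -[LHS]/(L t R) -[RHS]/(G t R); apply: tpow_eq => [a x y|a x y|a].
- by rewrite /L tmap2_linl tshuffle_linear.
- by rewrite /G tshuffle_linear tmap2_linl.
rewrite /L /G; move: t; apply: tpow_eq => [b x y|b x y|f].
- by rewrite tmap2_linr tshuffle_linear.
- by rewrite tshuffle_linear tmap2_linr.
rewrite !tmap2E !tshuffleE tmap2E; congr ptpow.
by apply/ffunP => i; rewrite !ffunE.
Qed.

Lemma tmap2_sym (R : sympow n U) (t : sympow n V) : symmetric_tensor (tmap2 m R t).
Proof. by apply/symmetric_tensorP => s; rewrite tmap2_shuffle !sympow_fix. Qed.

(* For U = A acting on V, this is the action of S^n(A) on S^n(V) by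
   multiplication in the n-th tensor power of A. *)
Definition smap2 (R : sympow n U) (t : sympow n V) : sympow n W :=
  Sympow (tmap2_sym R t).

End Tmap2.

Lemma tmap2_deriv (U V : lmodType K) (m : U -> V -> V) (D : V -> V) :
  bilin m -> linear D -> (forall u v, D (m u v) = m u (D v)) ->
  forall R t, tderiv D (tmap2 m R t) = tmap2 m R (tderiv D t).
Proof.
move=> bm lD mD R t; move: R.
apply: tpow_eq => [a x y|a x y|a].
- by rewrite tmap2_linl // tderiv_linear.
- by rewrite tmap2_linl.
move: t; apply: tpow_eq => [b x y|b x y|f].
- by rewrite tmap2_linr // tderiv_linear.
- by rewrite tderiv_linear // tmap2_linr.
rewrite !tmap2E // !tderivE // (lin_sum (tmap2_linr bm _)).
apply: eq_bigr => i _; rewrite tmap2E //; congr ptpow.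
by apply/ffunP => k; rewrite !ffunE; case: eqP => // ->; rewrite ?ffunE mD.
Qed.

End TensorPowerMaps.

Section SpecialLinear.
Variables (K : fieldType) (r : nat).

Definition traceless : {pred 'M[K]_r.+1} := fun x => \tr x == 0.

Lemma traceless_submod : submod_closed traceless.
Proof.
split=> [|a x y]; first by rewrite unfold_in raddf0.
by rewrite !unfold_in mxtraceD mxtraceZ => /eqP-> /eqP->; rewrite mulr0 addr0.
Qed.

HB.instance Definition _ :=
  GRing.isSubmodClosed.Build K 'M[K]_r.+1 traceless traceless_submod.

(* This is sl_{r+1}. *)
Record sl := Sl { slval :> 'M[K]_r.+1; slvalP : traceless slval }.

HB.instance Definition _ := [isSub for slval].
HB.instance Definition _ := [Choice of sl by <:].
HB.instance Definition _ := [SubChoice_isSubLmodule of sl by <:].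

Lemma slbr_traceless (x y : sl) : traceless (x *m y - y *m x).
Proof. by rewrite /traceless raddfB /= mxtrace_mulC subrr. Qed.

Definition slbr (x y : sl) : sl := Sl (slbr_traceless x y).

Definition lo (i : 'I_r) : 'I_r.+1 := widen_ord (leqnSn r) i.
Definition hi (i : 'I_r) : 'I_r.+1 := fintype.lift ord0 i.

Lemma coroot_traceless (i : 'I_r) :
  traceless (delta_mx (lo i) (lo i) - delta_mx (hi i) (hi i)).
Proof.
have T j : \tr (delta_mx j j : 'M[K]_r.+1) = 1.
  rewrite /mxtrace (bigD1 j) //= mxE !eqxx big1 ?addr0 // => k kj.
  by rewrite mxE (negbTE kj).
by rewrite /traceless raddfB /= !T subrr.
Qed.

Definition coroot (i : 'I_r) : sl := Sl (coroot_traceless i).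

(* The positive nilpotent subalgebra: strictly upper triangular matrices. *)
Definition npos (x : sl) := forall i j : 'I_r.+1, (j <= i)%N -> x i j = 0.

Definition cartan (h : sl) : bool := is_diag_mx h.

(* A weight in P is encoded by its values on the simple coroots. *)
Definition weight := {ffun 'I_r -> int}.

(* A diagonal traceless h equals sum_i (h_00 + ... + h_ii) coroot_i. *)
Definition weval (mu : weight) (h : sl) : K :=
  \sum_(i < r) (mu i)%:~R * \sum_(k < r.+1 | (k <= i)%N) h k k.

Lemma weval_coroot mu i : weval mu (coroot i) = (mu i)%:~R.
Proof.
rewrite /weval (bigD1 i) //= [X in _ + X]big1 ?addr0 => [|j ji].
  rewrite (bigD1 (lo i)) //= big1 ?addr0 => [|k /andP[ki kl]].
    by rewrite !mxE !eqxx /= andbb -val_eqE /= /bump /= add1n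
      (ltn_eqF (ltnSn i)) subr0 mulr1.
  rewrite !mxE (negbTE kl) /= -val_eqE /= /bump /= add1n.
  by rewrite (ltn_eqF (leq_ltn_trans ki (ltnSn i))) subr0.
have [lt_ij|le_ji] := ltnP i j.
  rewrite (bigD1 (lo i)) ?(ltnW lt_ij) //= (bigD1 (hi i)) /=; last first.
    by rewrite -!val_eqE /= /bump /= add1n lt_ij (gtn_eqF (ltnSn i)).
  rewrite big1 ?addr0 => [|k /andP[/andP[_ /negbTE kl] /negbTE kh]]; last first.
    by rewrite !mxE kl kh subr0.
  have lh : (lo i == hi i) = false.
    by rewrite -val_eqE /= /bump /= add1n ltn_eqF.
  by rewrite !mxE !eqxx [hi i == _]eq_sym !lh /= subr0 sub0r subrr mulr0.
rewrite big1 ?mulr0 // => k kj; rewrite !mxE.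
have ki : (k < i)%N.
  by apply: leq_ltn_trans kj _; rewrite ltn_neqAle le_ji andbT.
rewrite -!val_eqE /= /bump /= add1n (ltn_eqF ki).
by rewrite (ltn_eqF (ltn_trans ki (ltnSn i))) subr0.
Qed.

End SpecialLinear.

Section CurrentAlgebra.
Variables (K : fieldType) (r : nat) (A : comAlgType K).

(* The current Lie algebra sl_{r+1} (x) A. *)
Definition cur := tens (sl K r) A.
HB.instance Definition _ := GRing.Lmodule.on cur.

(* [x (x) P, y (x) Q] = [x, y] (x) PQ. *)
Definition curbr (X Y : cur) : cur :=
  tens_lift (fun x P => tens_lift (fun y Q => ptens (slbr x y) (P * Q)) Y) X.

Lemma slbr_linl y : linear ((@slbr K r)^~ y).
Proof.
move=> a u v; apply: val_inj => /=.
rewrite mulmxDl mulmxDr -scalemxAl -scalemxAr scalerBr opprD !addrA.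
by congr (_ - _); rewrite addrAC.
Qed.

Lemma slbr_linr x : linear (@slbr K r x).
Proof.
move=> a u v; apply: val_inj => /=.
rewrite mulmxDl mulmxDr -scalemxAl -scalemxAr scalerBr opprD !addrA.
by congr (_ - _); rewrite addrAC.
Qed.

Lemma amul_linl (Q : A) : linear ( *%R^~ Q).
Proof. by move=> a u v; rewrite mulrDl scalerAl. Qed.

Lemma amul_linr (P : A) : linear ( *%R P).
Proof. by move=> a u v; rewrite mulrDr scalerAr. Qed.

Lemma curbr_bilin_r (x : sl K r) (P : A) : bilin (fun (y : sl K r) (Q : A) => ptens (slbr x y) (P * Q)).
Proof.
split=> [Q|y] a u v; first by rewrite slbr_linr ptens_linl.
by rewrite amul_linr ptens_linr.
Qed.

Lemma curbr_bilin_l (Y : cur) :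
  bilin (fun (x : sl K r) (P : A) => tens_lift (fun (y : sl K r) Q => ptens (slbr x y) (P * Q)) Y).
Proof.
split=> [P|x] a u v /=; apply: tens_lift_lin => y Q.
  by rewrite slbr_linl ptens_linl.
by rewrite amul_linl ptens_linr.
Qed.

Lemma curbrE x P y Q : curbr (ptens x P) (ptens y Q) = ptens (slbr x y) (P * Q).
Proof.
rewrite /curbr tens_liftE; last exact: curbr_bilin_l.
by rewrite tens_liftE //; apply: curbr_bilin_r.
Qed.

Lemma curbr_linl Y : linear (curbr^~ Y).
Proof. exact/tens_lift_linear/curbr_bilin_l. Qed.

Lemma curbr_linr X : linear (curbr X).
Proof.
move=> a Y Z; apply: tens_lift_lin => x P.
by rewrite (tens_lift_linear (curbr_bilin_r x P)).
Qed.

(* Modules over the Lie algebra cur. *)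
Record curmod := Curmod {
  carrier :> lmodType K;
  act : cur -> carrier -> carrier;
  act_linl : forall w, linear (act^~ w);
  act_linr : forall X, linear (act X);
  act_br : forall X Y w, act (curbr X Y) w = act X (act Y w) - act Y (act X w)
}.

Definition equivariant (W W' : curmod) (f : W -> W') :=
  forall (X : cur) (w : W), f (act X w) = act X (f w).

(* V_{r+1} (x) A, the vector representation being the space of columns. *)
Section VectorModule.

Definition VA := tens 'cV[K]_r.+1 A.
HB.instance Definition _ := GRing.Lmodule.on VA.

Definition VAact (X : cur) (u : VA) : VA :=
  tens_lift (fun (x : sl K r) P =>
    tens_lift (fun w Q => ptens (slval x *m w) (P * Q)) u) X.

Lemma VAact_bilin_r (x : sl K r) (P : A) :
  bilin (fun (w : 'cV[K]_r.+1) Q => ptens (slval x *m w) (P * Q)).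
Proof.
split=> [Q|w] a u v; first by rewrite mulmxDr -scalemxAr ptens_linl.
by rewrite amul_linr ptens_linr.
Qed.

Lemma VAact_bilin_l (t : VA) :
  bilin (fun (x : sl K r) P =>
           tens_lift (fun w Q => ptens (slval x *m w) (P * Q)) t).
Proof.
split=> [P|x] a u v /=; apply: tens_lift_lin => w Q.
  by rewrite mulmxDl -scalemxAl ptens_linl.
by rewrite amul_linl ptens_linr.
Qed.

Lemma VAactE x P w Q :
  VAact (ptens x P) (ptens w Q) = ptens (slval x *m w) (P * Q).
Proof.
rewrite /VAact tens_liftE; last exact: VAact_bilin_l.
by rewrite tens_liftE //; apply: VAact_bilin_r.
Qed.

Lemma VAact_linl u : linear (VAact^~ u).
Proof. exact/tens_lift_linear/VAact_bilin_l. Qed.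

Lemma VAact_linr X : linear (VAact X).
Proof.
move=> a u v; apply: tens_lift_lin => x P.
by rewrite (tens_lift_linear (VAact_bilin_r x P)).
Qed.

Lemma VAact_br X Y u :
  VAact (curbr X Y) u = VAact X (VAact Y u) - VAact Y (VAact X u).
Proof.
have addBB (a : K) (p q p' q' : VA) :
  a *: (p - q) + (p' - q') = (a *: p + p') - (a *: q + q').
  by rewrite scalerBr opprD addrACA.
elim/tens_ind: X => [|a x P X IH].
  by rewrite (lin0 (curbr_linl _)) !(lin0 (VAact_linl _)) (lin0 (VAact_linr _)) subrr.
rewrite curbr_linl !VAact_linl VAact_linr IH -addBB; congr (_ *: _ + _) => {X IH a}.
elim/tens_ind: Y => [|a y Q Y IH].
  by rewrite (lin0 (curbr_linr _)) !(lin0 (VAact_linl _)) (lin0 (VAact_linr _)) subrr.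
rewrite curbr_linr !VAact_linl VAact_linr IH -addBB; congr (_ *: _ + _) => {Y IH a}.
elim/tens_ind: u => [|a w T u IH].
  by rewrite !(lin0 (VAact_linr _)) subrr.
rewrite !VAact_linr IH -addBB; congr (_ *: _ + _).
rewrite curbrE !VAactE /= mulmxBl -!mulmxA (linB (ptens_linl _)).
by congr (ptens _ _ - ptens _ _); rewrite ?mulrA // [Q * P]mulrC.
Qed.

Definition VAmod := Curmod VAact_linl VAact_linr VAact_br.

Definition VAscale (P : A) (u : VA) : VA :=
  tens_lift (fun w Q => ptens w (P * Q)) u.

Lemma VAscale_bilin_r P :
  bilin (fun (w : 'cV[K]_r.+1) (Q : A) => ptens w (P * Q)).
Proof.
by split=> [Q|w] a u v; rewrite ?ptens_linl // amul_linr ptens_linr.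
Qed.

Lemma VAscaleE P w Q : VAscale P (ptens w Q) = ptens w (P * Q).
Proof. exact/tens_liftE/VAscale_bilin_r. Qed.

Lemma VAscale_bilin : bilin VAscale.
Proof.
split=> [u|P]; last exact/tens_lift_linear/VAscale_bilin_r.
by move=> a P Q; apply: tens_lift_lin => w T; rewrite amul_linl ptens_linr.
Qed.

Lemma VAact_scale X P u : VAact X (VAscale P u) = VAscale P (VAact X u).
Proof.
have [_ sl] := VAscale_bilin.
elim/tens_ind: X => [|a x Q X IH].
  by rewrite !(lin0 (VAact_linl _)) (lin0 (sl _)).
rewrite !VAact_linl sl IH; congr (_ *: _ + _).
elim/tens_ind: u {IH} => [|b w T u IH].
  by rewrite (lin0 (VAact_linr _)) !(lin0 (sl _)) (lin0 (VAact_linr _)).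
rewrite VAact_linr !sl VAact_linr IH; congr (_ *: _ + _).
by rewrite VAactE !VAscaleE VAactE mulrCA.
Qed.

End VectorModule.

Section SymmetricPower.
Variables (n : nat) (W : curmod).

Lemma symact_sym (X : cur) (t : sympow n W) :
  symmetric_tensor (tderiv (act X) t).
Proof.
apply/symmetric_tensorP => s.
by rewrite tderiv_shuffle ?sympow_fix //; apply: act_linr.
Qed.

Definition symact (X : cur) (t : sympow n W) : sympow n W :=
  Sympow (symact_sym X t).

Lemma symact_linl t : linear (symact^~ t).
Proof.
move=> a X Y; apply: val_inj => /=.
by apply: tderiv_lin => [|||v]; rewrite ?act_linl //; apply: act_linr.
Qed.

Lemma symact_linr X : linear (symact X).
Proof. by move=> a t u; apply: val_inj; rewrite /= tderiv_linear //; apply: act_linr. Qed.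

Lemma symact_br X Y t :
  symact (curbr X Y) t = symact X (symact Y t) - symact Y (symact X t).
Proof.
apply: val_inj => /=.
by apply: tderiv_comm => [|||v]; rewrite ?act_br //; apply: act_linr.
Qed.

Definition symmod := Curmod symact_linl symact_linr symact_br.
End SymmetricPower.

Section QuotientModule.
Variables (W : curmod) (S : W -> Prop).
Hypothesis stableS : forall X w, S w -> S (act X w).

Definition qact (X : cur) : lquot S -> lquot S :=
  qlift (fun w => proj S (act X w)).

Lemma proj_act_linear X : linear (fun w : W => proj S (act X w)).
Proof. by move=> a u v; rewrite act_linr projD projZ. Qed.

Lemma qactE X w : qact X (proj S w) = proj S (act X w).
Proof.
rewrite /qact qliftE // => [|u Su]; first exact: proj_act_linear.
exact/proj0P/span_gen/stableS.
Qed.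

Lemma qact_linl q : linear (qact^~ q).
Proof. by move=> a X Y; rewrite -[q]qreprK !qactE act_linl projD projZ. Qed.

Lemma qact_linr X : linear (qact X).
Proof.
move=> a q p; rewrite -[q]qreprK -[p]qreprK -projZ -projD !qactE.
by rewrite act_linr projD projZ.
Qed.

Lemma qact_br X Y q :
  qact (curbr X Y) q = qact X (qact Y q) - qact Y (qact X q).
Proof. by rewrite -[q]qreprK !qactE act_br raddfB. Qed.

Definition quotmod := Curmod qact_linl qact_linr qact_br.
End QuotientModule.

(* ptens h 1 ranges over the Cartan subalgebra of g = g (x) 1. *)
Definition weight_space (W : curmod) (mu : weight r) (w : W) :=
  forall h : sl K r, cartan h -> act (ptens h 1) w = weval mu h *: w.

(* The last clause says that the sum of the weight spaces is direct. *)
Definition integrable (W : curmod) :=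
  exists D : seq (weight r), uniq D /\
    (forall w : W, exists f : weight r -> W,
       (forall mu, mu \in D -> weight_space mu (f mu)) /\
       w = \sum_(mu <- D) f mu) /\
    (forall f : weight r -> W,
       (forall mu, mu \in D -> weight_space mu (f mu)) ->
       \sum_(mu <- D) f mu = 0 -> forall mu, mu \in D -> f mu = 0).

Definition generated_by (W : curmod) (w : W) :=
  forall U : W -> Prop, U w ->
    (forall (a : K) u v, U u -> U v -> U (a *: u + v)) ->
    (forall X u, U u -> U (act X u)) -> forall u, U u.

Section LocalWeyl.
Variables (M : Type) (ev : M -> {lrmorphism A -> K^o}).
Variables (n : nat) (Z : 'I_n -> M).

(* The simple coroots h_1, ..., h_r are indexed from 0. *)
Definition weyl_vector (W : curmod) (w : W) :=
  [/\ forall x P, npos x -> act (ptens x P) w = 0,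
      forall (i : 'I_r) P, i = 0 :> nat ->
        act (ptens (coroot K i) P) w = (\sum_(j < n) (ev (Z j) P : K)) *: w &
      forall (i : 'I_r) P, (0 < i)%N -> act (ptens (coroot K i) P) w = 0].

Definition weyl_candidate (W : curmod) (w : W) :=
  [/\ integrable W, generated_by w & weyl_vector w].

(* The local Weyl module is characterised, with its generator, as the maximal
   candidate: any other candidate is its quotient. *)
Definition is_local_weyl (W : curmod) (w : W) :=
  weyl_candidate w /\
  forall (W' : curmod) (w' : W'), weyl_candidate w' ->
    exists f : {linear W -> W'},
      [/\ equivariant f, f w = w' & forall y, exists x, f x = y].

(* R |-> R(Z_1, ..., Z_n). *)
Definition teval : tpow n A -> K^o :=
  tpow_lift (fun a : {ffun 'I_n -> A} => \prod_(i < n) ev (Z i) (a i) : K^o).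

Lemma teval_multilin :
  multilin (fun a : {ffun 'I_n -> A} => \prod_(i < n) ev (Z i) (a i) : K^o).
Proof.
move=> f i b u v.
have E x : \prod_(j < n) ev (Z j) (upd f i x j) =
           ev (Z i) x * \prod_(j < n | j != i) ev (Z j) (f j).
  rewrite (bigD1 i) //= ffunE eqxx; congr (_ * _).
  by apply: eq_bigr => j ji; rewrite ffunE (negbTE ji).
by rewrite !E linearP mulrDl scalerAl.
Qed.

Lemma tevalE a : teval (ptpow a) = \prod_(i < n) ev (Z i) (a i).
Proof. exact/tpow_liftE/teval_multilin. Qed.

Definition J (R : sympow n A) : Prop := teval R = 0.

(* Generators of the subspace J S^n(V_{r+1} (x) A); sym_quotient divides out
   their linear span. *)
Definition JS (u : sympow n VA) : Prop :=
  exists R t, J R /\ u = smap2 VAscale_bilin R t.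

Lemma JS_stable X (u : symmod n VAmod) : JS u -> JS (act X u).
Proof.
case=> R [t [JR ->]]; exists R, (symact (W := VAmod) X t); split => //.
apply: val_inj => /=; apply: tmap2_deriv; first exact: VAscale_bilin.
  exact: VAact_linr.
by move=> P v; apply: VAact_scale.
Qed.

(* S^n(V_{r+1} (x) A) / J S^n(V_{r+1} (x) A). *)
Definition sym_quotient : curmod := quotmod JS_stable.

(* The class of (v (x) 1)^n, with v = e_0 the highest weight vector. *)
Definition sym_vector : sym_quotient :=
  proj JS (symconst n (ptens (delta_mx ord0 ord0 : 'cV[K]_r.+1) (1 : A))).

End LocalWeyl.

End CurrentAlgebra.

(* M is the zero locus of a set E of polynomials in an affine space, and ev
   identifies A with the algebra of restrictions to M of polynomials. *)
Definition affine_variety (K : fieldType) (M : Type) (A : comAlgType K)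
    (ev : M -> {lrmorphism A -> K^o}) :=
  (forall P : A, (forall z, ev z P = 0) -> P = 0) /\
  exists (m : nat) (iota : M -> 'I_m -> K) (E : {mpoly K[m]} -> Prop),
    [/\ forall z z', iota z =1 iota z' -> z = z',
        forall x : 'I_m -> K,
          (exists z, iota z =1 x) <-> (forall p, E p -> p.@[x] = 0) &
        forall f : M -> K,
          (exists P, forall z, f z = ev z P) <->
          (exists p : {mpoly K[m]}, forall z, f z = p.@[iota z])].

(* Main.v *)
Require Import Defs.
From HB Require Import structures.
From mathcomp Require Import all_boot fingroup perm all_algebra ring.
From mathcomp Require Import reals complex.

Set Implicit Arguments.
Unset Strict Implicit.
Unset Printing Implicit Defensive.

Import GRing.Theory.
Local Open Scope ring_scope.

(** The quotient of S^n(V (x) A) by J S^n(V (x) A) is shown to have the defining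
   property of the local Weyl module; a module with that property is unique up
   to an isomorphism matching the generators, whence the theorem.

   The organizing idea is that V = V_{r+1} is itself a commutative algebra:
   the highest weight vector e_0 is the unit, and e_i e_j = 0 for i, j > 0.
   Hence B = V (x) A is a commutative algebra, with product [vmul], and an
   element u of B acts on S^n(B) by its power sum, the sum over the n tensor
   slots of the multiplication by u in that slot.  For u = e_j (x) a with
   j > 0 this is the action of the lowering operator E_{j0} (x) a; for
   u = e_0 (x) a it is the action of the power sum of a in S^n(A).

   Let W be an integrable module with a cyclic vector w satisfying the Weyl
   relations.  On W the element u acts by [pact u], the lowering operator of u
   plus the scalar sum_j a(Z_j), where a is the e_0-coefficient of u.  These
   operators commute.  Newton's recursion
     L() = w,
     L(u, s_1, ..., s_k) = p(u) L(s) - sum_i L(s_1, ..., u s_i, ..., s_k)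
   ([newton]) then defines symmetric multilinear maps with values in W: over
   S^n(B) the same recursion produces the sum, over all injections of the
   arguments into the n slots, of the tensors with e_0 (x) 1 in the remaining
   slots.  For all X in the current algebra,
     X L(s) = sum_i L(s_1, ..., X s_i, ..., s_k) + L(X e_0, s_1, ..., s_k)
   ([newton_act]), by induction on k, from the case k = 0, which is the Weyl
   relations.

   The heart of the proof is that L vanishes on n + 1 arguments
   ([newton_vanish]).  With all arguments equal to e_1 (x) 1 the value is
   f^{n+1} w, which is 0 by sl_2-theory because W has finitely many weights;
   the operators sending e_1 (x) 1 to e_j (x) a then replace the arguments one
   at a time.  So L on n arguments, divided by n!, is an equivariant map
   S^n(B) -> W sending the n-th power of e_0 (x) 1 to w, on which the power sum
   of a in S^n(A) acts by sum_j a(Z_j).  In characteristic 0 the power sums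
   generate S^n(A) ([symprod_ind]), so R in S^n(A) acts by the scalar
   R(Z_1, ..., Z_n) ([weyl_map_tmap2]), and J is killed.  This gives the
   maximality of the quotient ([sym_quotient_maximal]).

   Conversely the quotient is integrable, being spanned by weight vectors with
   finitely many weights, and it is generated by the class of the n-th power of
   e_0 (x) 1, by the same generation statement applied to B: modulo J, the
   power sum of any u in B acts through a lowering operator and a scalar. *)

(** * Subspaces and symmetrized products *)

(** A predicate that defines a linear subspace. *)
Definition subspace (K : fieldType) (T : lmodType K) (Q : T -> Prop) :=
  Q 0 /\ forall a u v, Q u -> Q v -> Q (a *: u + v).

Section Subspace.
Variables (K : fieldType) (T : lmodType K) (Q : T -> Prop).
Hypothesis sQ : subspace Q.

Lemma subspaceZ a u : Q u -> Q (a *: u).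
Proof. by move=> Qu; rewrite -[_ *: _]addr0; apply: sQ.2 Qu sQ.1. Qed.

Lemma subspaceB u v : Q u -> Q v -> Q (u - v).
Proof. by move=> Qu Qv; rewrite addrC -scaleN1r; apply: sQ.2. Qed.

Lemma subspace_sum (I : Type) (r : seq I) (P : pred I) (F : I -> T) :
  (forall i, P i -> Q (F i)) -> Q (\sum_(i <- r | P i) F i).
Proof.
move=> QF; elim/big_rec: _ => [|i x Pi Qx]; first exact: sQ.1.
by rewrite -[F i]scale1r; apply: sQ.2 => //; apply: QF.
Qed.
End Subspace.

Section SymmetrizedProducts.
Variables (K : fieldType) (n : nat).
Hypothesis K0 : [pchar K] =i pred0.

Lemma natr_neq0 k : (0 < k)%N -> k%:R != 0 :> K.
Proof. by rewrite (pcharf0P K).1 // lt0n. Qed.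

(** Induction principle for functions G of n slots that are invariant under
    permutations of the slots: a subspace that contains the value of G at the
    constant unit tuple and is stable under power sums contains all the values
    of G.  It expresses that power sums generate symmetric functions in
    characteristic 0. *)
Lemma symprod_ind (B : Type) (one : B) (mul : B -> B -> B) (T : lmodType K)
    (G : {ffun 'I_n -> B} -> T) (Q : T -> Prop) :
  (forall u, mul u one = u) ->
  (forall (s : 'S_n) (f : {ffun 'I_n -> B}), G [ffun i => f (s i)] = G f) ->
  subspace Q -> Q (G [ffun=> one]) ->
  (forall u (f : {ffun 'I_n -> B}),
     Q (G f) -> Q (\sum_(l < n) G (upd f l (mul u (f l))))) ->
  forall f, Q (G f).
Proof.
move=> mul1 Gs sQ Q1 Qp f.
have [S [k [def_k f1]]] : exists S : {set 'I_n}, exists k,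
    #|S| = k /\ forall i, i \notin S -> f i = one.
  by exists setT, #|[set: 'I_n]|; split=> // i; rewrite inE.
(* Induction on the number k of slots that may differ from the unit. *)
elim: k => [|k IH] in S f def_k f1 *.
  rewrite (_ : f = [ffun=> one]) //; apply/ffunP=> i; rewrite ffunE f1 //.
  by rewrite (cards0_eq def_k) inE.
have [l Sl] : exists l, l \in S by apply/card_gt0P; rewrite def_k.
pose f' := upd f l one; pose S' := S :\ l.
have def_S' : #|S'| = k by apply/eqP; rewrite -eqSS -def_k (cardsD1 l S) Sl.
have f'1 i : i \notin S' -> f' i = one.
  by rewrite !inE negb_and negbK ffunE; case: eqP => //= _ /f1.
have := Qp (f l) _ (IH S' f' def_S' f'1).
rewrite (bigID (fun i => i \in S')) /= => Qsum.
have QS' : Q (\sum_(i < n | i \in S') G (upd f' i (mul (f l) (f' i)))).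
  apply: (subspace_sum sQ) => i S'i; apply: (IH S') => // j S'j.
  by rewrite ffunE; case: eqP => [ji|_]; [rewrite ji S'i in S'j | apply: f'1].
have {QS' Qsum} := subspaceB sQ Qsum QS'; rewrite addrAC subrr add0r.
(* Each slot outside S' holds the unit, so up to a permutation of the slots
   the l-th entry of f can be put back there. *)
rewrite (eq_bigr (fun=> G f)) => [|i S'i]; last first.
  rewrite f'1 // mul1 -[RHS](Gs (tperm l i)); congr G; apply/ffunP=> j.
  rewrite !ffunE; case: tpermP => [->|->|/eqP jl /eqP ji].
  - case: (eqVneq l i) => [-> //|li]; rewrite eqxx f1 //.
    by move: S'i; rewrite !inE eq_sym li.
  - by rewrite eqxx.
  - by rewrite (negPf ji) (negPf jl).
rewrite sumr_const -scaler_nat => /(subspaceZ sQ (#|[predC S']|%:R)^-1).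
rewrite scalerA mulVf ?scale1r //; apply: natr_neq0.
by apply/card_gt0P; exists l; rewrite !inE eqxx.
Qed.

Section Space.
Variable V : lmodType K.

(** The symmetrization of a pure tensor, without division by n!. *)
Definition symprod (f : {ffun 'I_n -> V}) : tpow n V :=
  \sum_(s : 'S_n) ptpow [ffun i => f (s i)].

Lemma symprod_perm (s : 'S_n) (f : {ffun 'I_n -> V}) :
  symprod [ffun i => f (s i)] = symprod f.
Proof.
rewrite /symprod [RHS](reindex_inj (mulIg s)) /=; apply: eq_bigr => t _.
by congr ptpow; apply/ffunP => i; rewrite !ffunE permM.
Qed.

Lemma symprod_const v : symprod [ffun=> v] = n`!%:R *: ptpow [ffun=> v].
Proof.
rewrite /symprod (eq_bigr (fun=> ptpow [ffun=> v])) => [|s _].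
  rewrite sumr_const -scaler_nat; congr (_%:R *: _).
  by rewrite card_Sn.
by congr ptpow; apply/ffunP=> i; rewrite !ffunE.
Qed.

Lemma tderiv_symprod (D : V -> V) f : linear D ->
  tderiv D (symprod f) = \sum_(l < n) symprod (upd f l (D (f l))).
Proof.
move=> lD; rewrite (lin_sum (tderiv_linear lD)) [RHS]exchange_big /=.
apply: eq_bigr => s _; rewrite tderivE // [RHS](reindex_perm s) /=.
apply: eq_bigr => i _; congr ptpow; apply/ffunP => j.
by rewrite !ffunE (inj_eq perm_inj).
Qed.

Lemma symprod_sym f : symmetric_tensor (symprod f).
Proof.
apply/symmetric_tensorP => s; rewrite (lin_sum (tshuffle_linear s)).
rewrite /symprod [RHS](reindex_inj (mulgI s)) /=; apply: eq_bigr => t _.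
by rewrite tshuffleE; congr ptpow; apply/ffunP => i; rewrite !ffunE permM.
Qed.

Lemma symmetric_span (P : tpow n V -> Prop) :
  subspace P -> (forall f, P (symprod f)) ->
  forall t : sympow n V, P t.
Proof.
move=> sP PG t.
have PA u : P (\sum_(s : 'S_n) tshuffle s u).
  elim/tpow_ind: u => [|a f u IH].
    by rewrite big1 => [|s _]; [apply: sP.1 | apply/lin0/tshuffle_linear].
  rewrite (eq_bigr (fun s : 'S_n =>
      a *: ptpow [ffun i => f (s i)] + tshuffle s u)).
    by rewrite big_split -scaler_sumr; apply: sP.2 IH; apply: PG.
  by move=> s _; rewrite tshuffle_linear tshuffleE.
have := PA t; under eq_bigr do rewrite sympow_fix.
rewrite sumr_const -scaler_nat => /(subspaceZ sP (n`!%:R)^-1).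
by rewrite scalerA card_Sn mulVf ?scale1r // natr_neq0 // fact_gt0.
Qed.

End Space.
End SymmetrizedProducts.

(** * The Newton recursion *)

Section Newton.
Variables (K : fieldType) (B W : lmodType K).

(** The sequences obtained from s by applying g to one of its entries. *)
Fixpoint slotwise (g : B -> B) (s : seq B) : seq (seq B) :=
  if s is x :: s' then (g x :: s') :: [seq x :: z | z <- slotwise g s']
  else [::].

Lemma slotwise_cat g s t : slotwise g (s ++ t) =
  [seq z ++ t | z <- slotwise g s] ++ [seq s ++ z | z <- slotwise g t].
Proof.
elim: s => [|x s IH] /=; first by rewrite map_id.
by rewrite IH map_cat -!map_comp.
Qed.

Lemma size_slotwise g s z : z \in slotwise g s -> size z = size s.
Proof.
elim: s z => //= x s IH z; rewrite inE => /predU1P[->//|/mapP[y /IH <- ->]].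
by [].
Qed.

Lemma size_slotwise_all g s : size (slotwise g s) = size s.
Proof. by elim: s => //= x s <-; rewrite size_map. Qed.

Lemma eq_slotwise g h s : g =1 h -> slotwise g s = slotwise h s.
Proof. by move=> gh; elim: s => //= x s ->; rewrite gh. Qed.

Lemma slotwise_nseq g x q z : z \in slotwise g (nseq q x) ->
  exists a b, (a + b).+1 = q /\ z = nseq a x ++ g x :: nseq b x.
Proof.
elim: q z => [|q IH] z //=; rewrite inE => /predU1P[->|].
  by exists 0%N, q.
by case/mapP=> y /IH[a [b [<- ->]]] ->; exists a.+1, b.
Qed.

Lemma slotwise_consE (H : seq B -> W) g x s :
  \sum_(z <- slotwise g (x :: s)) H z =
  H (g x :: s) + \sum_(z <- slotwise g s) H (x :: z).
Proof. by rewrite big_cons big_map. Qed.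

(** The sequences obtained from s by applying g to one entry and h to another
    one. *)
Fixpoint slot2wise (g h : B -> B) (s : seq B) : seq (seq B) :=
  if s is x :: s' then
    [seq g x :: z | z <- slotwise h s'] ++ [seq h x :: z | z <- slotwise g s']
      ++ [seq x :: z | z <- slot2wise g h s']
  else [::].

Lemma slot2wiseC (H : seq B -> W) g h s :
  \sum_(z <- slot2wise g h s) H z = \sum_(z <- slot2wise h g s) H z.
Proof.
elim: s H => [|x s IH] H /=; first by rewrite !big_nil.
by rewrite !big_cat !big_map /= addrCA IH.
Qed.

Lemma slotwise_comp (H : seq B -> W) g h s :
  \sum_(z <- slotwise g s) \sum_(y <- slotwise h z) H y =
  \sum_(y <- slotwise (h \o g) s) H y + \sum_(y <- slot2wise g h s) H y.
Proof.
elim: s H => [|x s IH] H; first by rewrite !big_nil addr0.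
rewrite !slotwise_consE /= !big_cat !big_map /=.
under [X in _ + X = _]eq_bigr do rewrite slotwise_consE.
rewrite big_split /= IH -!addrA; congr (_ + _).
by rewrite [RHS]addrCA; congr (_ + _); rewrite [RHS]addrCA.
Qed.

(** H is linear in each entry of the sequences of size k. *)
Definition slotlinear (k : nat) (H : seq B -> W) :=
  forall a b c x y, (size a + size b).+1 = k ->
    H (a ++ (c *: x + y) :: b) = c *: H (a ++ x :: b) + H (a ++ y :: b).

Lemma slotwise_lin k H (g g1 g2 : B -> B) c s :
  slotlinear k H -> size s = k -> (forall x, g x = c *: g1 x + g2 x) ->
  \sum_(z <- slotwise g s) H z =
  c *: (\sum_(z <- slotwise g1 s) H z) + \sum_(z <- slotwise g2 s) H z.
Proof.
elim: s k H => [|x s IH] k H lH /= sk gE.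
  by rewrite !big_nil scaler0 addr0.
rewrite !big_cons !big_map gE (lH [::]) //= scalerDr addrACA.
rewrite (IH (size s) (fun z => H (x :: z))) //.
by move=> a b d y y' sab; apply: (lH (x :: a)); rewrite /= addSn sab sk.
Qed.

Variables (mul : B -> B -> B) (p : B -> W -> W) (w : W).

(** The first argument bounds the recursion; it is always the size of the
    sequence. *)
Fixpoint newton_rec (k : nat) (s : seq B) : W :=
  match k, s with
  | k'.+1, u :: s' => p u (newton_rec k' s') -
                      \sum_(z <- slotwise (mul u) s') newton_rec k' z
  | _, _ => w
  end.

(** The polarized elementary symmetric functions attached to the power sums p,
    applied to the vector w. They are locked to keep unification from unfolding
    the recursion. *)
Definition newton (s : seq B) : W := locked newton_rec (size s) s.

Lemma newton_nil : newton [::] = w. Proof. by rewrite /newton -lock. Qed.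

Lemma newton_cons u s :
  newton (u :: s) = p u (newton s) - \sum_(z <- slotwise (mul u) s) newton z.
Proof.
rewrite /newton -lock /=; congr (_ - _); apply: eq_big_seq => z zs.
by rewrite (size_slotwise zs).
Qed.

Lemma newton_mul u s :
  p u (newton s) = newton (u :: s) + \sum_(z <- slotwise (mul u) s) newton z.
Proof. by rewrite newton_cons subrK. Qed.

Hypothesis mulC : forall u v, mul u v = mul v u.
Hypothesis mulCA : forall u v x, mul u (mul v x) = mul v (mul u x).
Hypothesis pC : forall u v y, p u (p v y) = p v (p u y).
Hypothesis p_linl : forall y, linear (p^~ y).
Hypothesis p_linr : forall u, linear (p u).
Hypothesis mul_linl : forall x, linear (mul^~ x).

Lemma newton_swap u v s : newton (u :: v :: s) = newton (v :: u :: s).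
Proof.
have E a b : newton (a :: b :: s) =
    p a (p b (newton s)) - newton (mul a b :: s)
    - (p a (\sum_(z <- slotwise (mul b) s) newton z) +
       p b (\sum_(z <- slotwise (mul a) s) newton z))
    + \sum_(z <- slotwise (mul a) s) \sum_(y <- slotwise (mul b) z) newton y.
  rewrite newton_cons slotwise_consE newton_cons (linB (p_linr a)).
  under [X in _ - (_ + X) = _]eq_bigr do rewrite newton_cons.
  rewrite sumrB -(lin_sum (p_linr b)) !opprD !opprK !addrA; congr (_ - _ + _).
  by rewrite addrAC.
rewrite !E pC mulC [X in _ - _ - X + _]addrC; congr (_ + _).
rewrite !slotwise_comp slot2wiseC; congr (_ + _).
elim: s (newton) {E} => [|x s IH] H; first by rewrite !big_nil.
by rewrite !slotwise_consE /= mulCA IH.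
Qed.

Lemma newton_swap_at a x y b :
  newton (a ++ x :: y :: b) = newton (a ++ y :: x :: b).
Proof.
have [k] := ubnP (size a); elim: k a x y b => // k IH [|z a] x y b /= sa.
  exact: newton_swap.
have {}sa : (size a < k)%N by [].
rewrite !newton_cons (IH a) //; congr (_ - _).
rewrite !slotwise_cat !big_cat !big_map; congr (_ + _).
  by apply: eq_big_seq => c /size_slotwise sc; rewrite IH // sc.
rewrite !slotwise_consE (IH a (mul z x)) // (IH a x (mul z y)) // addrCA.
by congr (_ + (_ + _)); apply: eq_bigr => c _; rewrite IH.
Qed.

(** The symmetry of newton: any entry can be moved to the front. *)
Lemma newton_front a x b : newton (a ++ x :: b) = newton (x :: a ++ b).
Proof.
elim/last_ind: a => // a y IH in b *.
by rewrite cat_rcons newton_swap_at IH cat_rcons.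
Qed.

Lemma newton_slotlinear k : slotlinear k newton.
Proof.
elim: k => [|k IH] a b c x y // [sk].
rewrite !newton_front !newton_cons p_linl.
rewrite (slotwise_lin IH (g1 := mul x) (g2 := mul y) (c := c)) ?size_cat //.
  by rewrite scalerBr opprD addrACA.
by move=> z; rewrite mul_linl.
Qed.

Lemma newton_linear s : linear (fun u => newton (u :: s)).
Proof. by move=> c x y; apply: (@newton_slotlinear _ [::]). Qed.

Lemma newton_slotwise_nseq g us x q :
  \sum_(z <- slotwise g (us ++ nseq q x)) newton z =
  \sum_(z <- slotwise g us) newton (z ++ nseq q x) +
  newton (g x :: us ++ nseq q.-1 x) *+ q.
Proof.
rewrite slotwise_cat big_cat !big_map; congr (_ + _).
rewrite big_seq (eq_bigr (fun=> newton (g x :: us ++ nseq q.-1 x))) => [|z].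
  rewrite -big_seq big_const_seq count_predT size_slotwise_all size_nseq.
  by rewrite iter_addr addr0.
case/slotwise_nseq => a [b [<- ->]] /=.
by rewrite catA newton_front -catA -nseqD.
Qed.

Section Equivariance.
Variables (X : Type) (aB : X -> B -> B) (aW : X -> W -> W) (one : B).
Variable (br : X -> B -> X).
Hypothesis aW_lin : forall x, linear (aW x).
Hypothesis mulu1 : forall u, mul u one = u.
Hypothesis aW_p : forall x u y, aW x (p u y) = p u (aW x y) + aW (br x u) y.
Hypothesis aB_mul : forall x u b,
  aB x (mul u b) = mul u (aB x b) + aB (br x u) b.
Hypothesis aWw : forall x, aW x w = p (aB x one) w.

(** The operators aB x on B and aW x on W are compatible when both have the same
    commutator, given by br x u, with the multiplication by u and with p u.
    Then newton is equivariant, up to the new entry that records the action on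
    the unit, which fills the slots not listed in s. *)
Lemma newton_act x s :
  aW x (newton s) =
  \sum_(z <- slotwise (aB x) s) newton z + newton (aB x one :: s).
Proof.
have [k] := ubnP (size s); elim: k x s => // k IH x [|u s] /= sk.
  by rewrite newton_cons !big_nil add0r newton_nil aWw subr0.
have {}sk : (size s < k)%N by [].
have Hs t : size t = size s -> aW x (newton t) =
  \sum_(z <- slotwise (aB x) t) newton z + newton (aB x one :: t).
  by move=> st; apply: IH; rewrite st.
rewrite newton_cons (linB (aW_lin x)) aW_p Hs // (IH _ s) //.
rewrite (lin_sum (aW_lin x)) [X in _ - X = _](_ : _ =
    \sum_(z <- slotwise (mul u) s) \sum_(y <- slotwise (aB x) z) newton y +
    \sum_(z <- slotwise (mul u) s) newton (aB x one :: z)); last first.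
  by rewrite -big_split; apply: eq_big_seq => z /size_slotwise/Hs.
rewrite (linD (p_linr u)) (lin_sum (p_linr u)).
under [X in X + _ + _ - _ = _]eq_bigr do rewrite newton_mul.
rewrite big_split /= newton_mul !slotwise_consE !slotwise_comp.
rewrite (slot2wiseC _ (mul u)) (newton_swap (aB x one)).
(* The pairs of distinct slots cancel; what is left follows from the
   commutation relation of aB x with the multiplication by u. *)
have -> : \sum_(z <- slotwise (aB x \o mul u) s) newton z =
    \sum_(z <- slotwise (mul u \o aB x) s) newton z +
    \sum_(z <- slotwise (aB (br x u)) s) newton z.
  rewrite (slotwise_lin (c := 1) (g1 := mul u \o aB x) (g2 := aB (br x u))
     (@newton_slotlinear (size s))) ?scale1r // => b.
  by rewrite scale1r /= aB_mul.
have -> : newton (aB x u :: s) =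
    newton (mul u (aB x one) :: s) + newton (aB (br x u) one :: s).
  by rewrite -(linD (newton_linear s)) -aB_mul mulu1.
apply/eqP; rewrite subr_eq; apply/eqP; rewrite !addrA.
by rewrite [LHS](ACl (5*8*1*4*2*7*3*6)).
Qed.
End Equivariance.
End Newton.

Section Slots.
Variables (K : fieldType) (B W : lmodType K) (n : nat).

Lemma slotlinear_multilin (H : seq B -> W) : slotlinear n H ->
  multilin (fun f : {ffun 'I_n -> B} => H [seq f i | i <- enum 'I_n]).
Proof.
move=> lH f i a u v; have := size_enum_ord n; have := enum_uniq 'I_n.
have: i \in enum 'I_n by rewrite mem_enum.
case/splitPr=> s1 s2; rewrite cat_uniq /= => /and3P[_].
rewrite negb_or => /andP[i1 _] /andP[i2 _].
rewrite size_cat /= addnS => sz.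
have E x : [seq upd f i x j | j <- s1 ++ i :: s2] =
    [seq f j | j <- s1] ++ x :: [seq f j | j <- s2].
  rewrite map_cat /= ffunE eqxx; congr (_ ++ _ :: _); apply/eq_in_map => j js.
    by rewrite ffunE; case: eqP => // ji; rewrite -ji js in i1.
  by rewrite ffunE; case: eqP => // ji; rewrite -ji js in i2.
by rewrite !E lH // !size_map.
Qed.

Lemma slotwise_map (H : seq B -> W) (g : B -> B) (f : {ffun 'I_n -> B}) e :
  uniq e ->
  \sum_(z <- slotwise g [seq f j | j <- e]) H z =
  \sum_(i <- e) H [seq upd f i (g (f i)) j | j <- e].
Proof.
elim: e H => [|i e IH] H /=; first by rewrite !big_nil.
case/andP=> ie ue; rewrite !big_cons big_map ffunE eqxx.
rewrite (IH (fun z => H (_ :: z)) ue); congr (H (_ :: _) + _).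
  apply/eq_in_map => j je; rewrite ffunE; case: eqP => // ji.
  by rewrite -ji je in ie.
apply: eq_big_seq => j je; rewrite ffunE; case: eqP => // ij.
by rewrite ij je in ie.
Qed.
End Slots.

(** * The vector representation as a commutative algebra *)

Section VectorAlgebra.
Variables (K : fieldType) (r : nat) (A : comAlgType K).
Implicit Types (u v : VA r A) (a b : A) (i j k : 'I_r.+1).

Notation cur := (cur r A).
Notation VA := (VA r A).

Lemma elem_traceless i j : traceless (delta_mx i j *+ (i != j) : 'M[K]_r.+1).
Proof.
rewrite /traceless; case: (eqVneq i j) => [_|ij].
  by rewrite mulr0n mxtrace0.
rewrite mulr1n; apply/eqP.
rewrite /mxtrace big1 // => k _; rewrite mxE.
by case: (k =P i) => // ->; rewrite (negPf ij).
Qed.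

(** The matrix unit E_ij for i != j; for i = j it is 0. *)
Definition elem i j : sl K r := Sl (elem_traceless i j).

Lemma diff_traceless i j :
  traceless (delta_mx i i - delta_mx j j : 'M[K]_r.+1).
Proof.
have T l : \tr (delta_mx l l : 'M[K]_r.+1) = 1.
  rewrite /mxtrace (bigD1 l) //= mxE !eqxx big1 ?addr0 // => k kl.
  by rewrite mxE (negPf kl).
by rewrite /traceless raddfB /= !T subrr.
Qed.

(** E_ii - E_jj, the coroot of the root of E_ij. *)
Definition hdiff i j : sl K r := Sl (diff_traceless i j).

(** e_i (x) a. *)
Definition vec i a : VA := ptens (delta_mx i 0 : 'cV[K]_r.+1) a.

Lemma vec_linear i : linear (vec i).
Proof. exact: ptens_linr. Qed.

Lemma vec0 i : vec i 0 = 0.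
Proof. exact/lin0/vec_linear. Qed.

Lemma ptens_vec (w : 'cV[K]_r.+1) a : ptens w a = \sum_i vec i (w i 0 *: a).
Proof.
rewrite {1}[w]matrix_sum_delta; under eq_bigr do rewrite big_ord1.
rewrite (lin_sum (ptens_linl (V := A) a)); apply: eq_bigr => i _.
by rewrite (linZ (ptens_linl (V := A) a)) (linZ (vec_linear i)).
Qed.

Lemma VA_span (P : VA -> Prop) : subspace P -> (forall i a, P (vec i a)) ->
  forall u, P u.
Proof.
move=> sP Pv; elim/tens_ind => [|c w a u IH]; first exact: sP.1.
by apply: sP.2 IH; rewrite ptens_vec; apply: subspace_sum.
Qed.

(** The coefficient in A of e_i. *)
Definition coef i u : A := tens_lift (fun (w : 'cV[K]_r.+1) a => w i 0 *: a) u.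

Lemma coef_bilin i : bilin (fun (w : 'cV[K]_r.+1) (a : A) => w i 0 *: a).
Proof.
split=> [a|w] c x y; first by rewrite !mxE scalerDl scalerA.
by rewrite scalerDr !scalerA mulrC.
Qed.

Lemma coefE i (w : 'cV[K]_r.+1) a : coef i (ptens w a) = w i 0 *: a.
Proof. exact/tens_liftE/coef_bilin. Qed.

Lemma coef_linear i : linear (coef i).
Proof. exact/tens_lift_linear/coef_bilin. Qed.

Lemma coef_vec i j a : coef i (vec j a) = a *+ (i == j).
Proof. by rewrite coefE mxE eqxx andbT scaler_nat. Qed.

Lemma VAact_vec x P j a :
  VAact (ptens x P) (vec j a) = \sum_i vec i (x i j *: (P * a)).
Proof.
rewrite VAactE ptens_vec; apply: eq_bigr => i _; congr (vec i (_ *: _)).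
rewrite mxE (bigD1 j) //= mxE !eqxx mulr1 big1 ?addr0 // => k kj.
by rewrite mxE (negPf kj) mulr0.
Qed.

Lemma VAact_elem i j P k a :
  VAact (ptens (elem i j) P) (vec k a) =
  vec i (P * a) *+ ((i != j) && (j == k)).
Proof.
rewrite VAact_vec (bigD1 i) //= big1 => [|l li]; last first.
  by rewrite mulmxnE mxE (negPf li) /= mul0rn scale0r vec0.
rewrite addr0 mulmxnE mxE eqxx /= eq_sym; case: (i != j); case: (j == k) => //=;
by rewrite ?mul0rn ?mulr0n ?scale0r ?vec0 // scale1r.
Qed.

Lemma VAscale_vec P i a : VAscale P (vec i a) = vec i (P * a).
Proof. exact: VAscaleE. Qed.

Lemma VAscale_linl u : linear ((@VAscale K r A)^~ u).
Proof. exact: (VAscale_bilin r A).1. Qed.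

Lemma VAscale_linr P : linear (VAscale P : VA -> VA).
Proof. exact: (VAscale_bilin r A).2. Qed.

Lemma VAscaleA a b u : VAscale (a * b) u = VAscale a (VAscale b u).
Proof.
elim/VA_span: u => [|i c]; last by rewrite !VAscale_vec mulrA.
split=> [|c u v Eu Ev]; first by rewrite !(lin0 (VAscale_linr _)).
by rewrite !(VAscale_linr _ c) Eu Ev.
Qed.

Lemma VAscale1 u : VAscale 1 u = u.
Proof.
elim/VA_span: u => [|i c]; last by rewrite VAscale_vec mul1r.
split=> [|c u v Eu Ev]; first by rewrite (lin0 (VAscale_linr _)).
by rewrite (VAscale_linr _ c) Eu Ev.
Qed.

(** The lowering operator sum_j E_{j0} (x) u_j over j > 0, where u_j is the
    coefficient of e_j in u; the term j = 0 vanishes. *)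
Definition lower u : cur := \sum_j ptens (elem j 0) (coef j u).

Lemma lower_linear : linear lower.
Proof.
move=> c u v; rewrite /lower scaler_sumr -big_split; apply: eq_bigr => j _.
by rewrite coef_linear ptens_linr.
Qed.

Lemma lower_vec i a : lower (vec i a) = ptens (elem i 0) a.
Proof.
rewrite /lower (bigD1 i) //= coef_vec eqxx big1 ?addr0 // => j ji.
by rewrite coef_vec (negPf ji) (lin0 (ptens_linr _)).
Qed.

Lemma elem0 i : elem i i = 0.
Proof. by apply: val_inj; rewrite /= eqxx. Qed.

Lemma lower_comm u v : curbr (lower u) (lower v) = 0.
Proof.
elim/VA_span: u => [|i a].
  split; first by rewrite (lin0 lower_linear) (lin0 (curbr_linl _)).
  by move=> c x y Ex Ey; rewrite lower_linear curbr_linl Ex Ey scaler0 addr0.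
elim/VA_span: v => [|j b].
  split; first by rewrite (lin0 lower_linear) (lin0 (curbr_linr _)).
  by move=> c x y Ex Ey; rewrite lower_linear curbr_linr Ex Ey scaler0 addr0.
rewrite !lower_vec curbrE (_ : slbr _ _ = 0) ?(lin0 (ptens_linl _)) //.
apply: val_inj => /=; rewrite -!scaler_nat -!scalemxAl -!scalemxAr.
case: (eqVneq j 0) => [->|j0]; case: (eqVneq i 0) => [->|i0] /=;
  rewrite ?scale0r ?scaler0 ?subrr //.
by rewrite !mul_delta_mx_0 ?scaler0 ?subrr // eq_sym.
Qed.

(** The product of V (x) A for which e_0 is the unit of V and e_i e_j = 0 for
    i, j > 0, see vmul_vec. *)
Definition vmul u v : VA := VAact (lower u) v + VAscale (coef 0 u) v.

Lemma vmul_linl v : linear (vmul^~ v).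
Proof.
move=> c x y; rewrite /vmul (lower_linear c x y) (coef_linear 0 c x y).
rewrite (VAact_linl v c) (VAscale_linl v c).
by rewrite scalerDr addrACA.
Qed.

Lemma vmul_linr u : linear (vmul u).
Proof.
move=> c x y; rewrite /vmul VAact_linr VAscale_linr.
by rewrite scalerDr addrACA.
Qed.

Lemma vmul_vec i j a b : vmul (vec i a) (vec j b) =
  if i == 0 then vec j (a * b) else if j == 0 then vec i (a * b) else 0.
Proof.
rewrite /vmul lower_vec VAact_elem coef_vec VAscale_vec.
rewrite [0 == i]eq_sym [0 == j]eq_sym.
case: eqVneq => _ /=; first by rewrite add0r.
by rewrite mul0r vec0 addr0; case: eqP.
Qed.

Lemma lower_vec0 a : lower (vec 0 a) = 0.
Proof. by rewrite lower_vec elem0 (lin0 (ptens_linl _)). Qed.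

Lemma vmul_vec0 a v : vmul (vec 0 a) v = VAscale a v.
Proof. by rewrite /vmul lower_vec0 (lin0 (VAact_linl _)) add0r coef_vec. Qed.

Lemma vmulC u v : vmul u v = vmul v u.
Proof.
elim/VA_span: u => [|i a].
  split; first by rewrite (lin0 (vmul_linl _)) (lin0 (vmul_linr _)).
  by move=> c x y Ex Ey; rewrite vmul_linl vmul_linr Ex Ey.
elim/VA_span: v => [|j b].
  split; first by rewrite (lin0 (vmul_linl _)) (lin0 (vmul_linr _)).
  by move=> c x y Ex Ey; rewrite vmul_linl vmul_linr Ex Ey.
rewrite !vmul_vec mulrC; case: (eqVneq i 0) => [->|i0]; last by case: ifP.
by case: eqP => // ->.
Qed.

Lemma vmulCA u v w : vmul u (vmul v w) = vmul v (vmul u w).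
Proof.
elim/VA_span: u => [|i a].
  split; first by rewrite !(lin0 (vmul_linl _)) (lin0 (vmul_linr _)).
  by move=> c x y Ex Ey; rewrite !vmul_linl vmul_linr Ex Ey.
elim/VA_span: v => [|j b].
  split; first by rewrite !(lin0 (vmul_linl _)) (lin0 (vmul_linr _)).
  by move=> c x y Ex Ey; rewrite !vmul_linl vmul_linr Ex Ey.
elim/VA_span: w => [|k d].
  split; first by rewrite !(lin0 (vmul_linr _)).
  by move=> c x y Ex Ey; rewrite !vmul_linr Ex Ey.
rewrite !vmul_vec.
case: (eqVneq i 0) => i0; case: (eqVneq j 0) => j0; case: (eqVneq k 0) => k0;
  rewrite ?(lin0 (vmul_linr _)) ?vmul_vec ?i0 ?j0 ?k0 ?eqxx
    ?(negPf i0) ?(negPf j0) ?(negPf k0) //;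
  by rewrite ?(negPf i0) ?(negPf j0) ?(negPf k0) // mulrCA.
Qed.

(** The unit e_0 (x) 1, which is also the highest weight vector. *)
Definition vone : VA := vec 0 1.

Lemma vmul1 u : vmul u vone = u.
Proof.
rewrite vmulC; elim/VA_span: u => [|i a].
  split; first by rewrite (lin0 (vmul_linr _)).
  by move=> c x y Ex Ey; rewrite vmul_linr Ex Ey.
by rewrite vmul_vec eqxx mul1r.
Qed.

Lemma VAact_vmul (X : cur) u v :
  VAact X (vmul u v) = vmul u (VAact X v) + VAact (curbr X (lower u)) v.
Proof.
rewrite /vmul (linD (VAact_linr X)) VAact_scale VAact_br [RHS]addrC.
by rewrite addrA subrK.
Qed.

End VectorAlgebra.

Section Brackets.
Variables (K : fieldType) (r : nat) (A : comAlgType K).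
Implicit Types (i j k : 'I_r.+1) (a : A).

Lemma val_hdiff i j : hdiff K i j = delta_mx i i - delta_mx j j :> 'M_r.+1.
Proof. by []. Qed.

Lemma slbr_elem i j : i != j -> slbr (elem K i j) (elem K j i) = hdiff K i j.
Proof.
move=> ij; apply: val_inj => /=.
by rewrite ij eq_sym ij !mulr1n !mul_delta_mx.
Qed.

Lemma slbr_hdiff i j : i != j ->
  slbr (hdiff K i j) (elem K j i) = (- 2%:R) *: elem K j i.
Proof.
move=> ij; apply: val_inj => /=.
have ji : j != i by rewrite eq_sym.
rewrite ji !mulr1n mulmxBl mulmxBr !mul_delta_mx !mul_delta_mx_0 //.
by rewrite sub0r subr0 -opprD scaleNr scaler_nat mulr2n.
Qed.

Lemma hdiff_diff i j : hdiff K i j = hdiff K 0 j - hdiff K 0 i.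
Proof. by apply: val_inj; rewrite /= opprB [RHS]addrC addrA subrK. Qed.

Lemma cartan_hdiff i j : cartan (hdiff K i j).
Proof.
apply/is_diag_mxP => k l kl.
have N m : ((k == m) && (l == m)) = false.
  by apply/negP => /andP[/eqP km /eqP lm]; rewrite km lm eqxx in kl.
by rewrite !mxE !N subrr.
Qed.

Lemma VAact_hdiff i j P k a : VAact (ptens (hdiff K i j) P) (vec k a) =
  vec k (((k == i)%:R - (k == j)%:R) *: (P * a)) :> VA r A.
Proof.
rewrite VAact_vec (bigD1 k) //= big1 ?addr0 => [|l lk]; last first.
  rewrite !mxE; case: (l =P i) => [<-|_]; case: (l =P j) => [<-|_];
  by rewrite /= ?[k == l]eq_sym ?(negPf lk) ?subrr scale0r vec0.
by rewrite !mxE !andbb.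
Qed.

Lemma sl_decomp (x : sl K r) :
  x = \sum_i \sum_j x i j *: elem K i j - \sum_j x j j *: hdiff K 0 j.
Proof.
have lv : linear (fun y : sl K r => slval y) by [].
have tr0 : \sum_j x j j = 0 by apply/eqP: (slvalP x).
apply: val_inj; rewrite -[LHS]/(slval x) -[RHS]/(slval _).
rewrite (linB lv) !(lin_sum lv).
rewrite [X in _ - X](_ : _ = - \sum_j x j j *: delta_mx j j); last first.
  under eq_bigr do rewrite (linZ lv) val_hdiff scalerBr.
  by rewrite sumrB -scaler_suml tr0 scale0r sub0r.
rewrite opprK -big_split {1}[slval x]matrix_sum_delta; apply: eq_bigr => i _ /=.
rewrite (lin_sum lv) (bigD1 i) //= [in RHS](bigD1 i) //= eqxx scaler0 add0r.
rewrite addrC; congr (_ + _); apply: eq_bigr => j ji.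
by rewrite eq_sym ji.
Qed.

End Brackets.

(** * Evaluation at the multiset of points *)

Section Evaluation.
Variables (K : fieldType) (r : nat) (A : comAlgType K).
Variables (M : Type) (ev : M -> {lrmorphism A -> K^o}).
Variables (n : nat) (Z : 'I_n -> M).

(** The value at (Z_1, ..., Z_n) of the power sum of a. *)
Definition powersum (a : A) : K := \sum_(j < n) ev (Z j) a.

Lemma powersum_linear : linear (powersum : A -> K^o).
Proof.
move=> c a b; rewrite /powersum scaler_sumr -big_split; apply: eq_bigr => j _.
by rewrite linearP.
Qed.

Lemma powersum1 : powersum 1 = n%:R.
Proof.
rewrite /powersum (eq_bigr (fun=> 1)) => [|j _]; last exact: rmorph1.
by rewrite sumr_const card_ord.
Qed.

Lemma teval_linear : linear (teval ev Z).
Proof. exact/tpow_lift_linear/teval_multilin. Qed.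

(** The operator tderiv of the multiplication by a is the multiplication by the
    power sum of a in the n-th tensor power of A. *)
Lemma teval_deriv (a : A) R :
  teval ev Z (tderiv ( *%R a) R) = powersum a *: teval ev Z R.
Proof.
have la : linear ( *%R a) := amul_linr a.
move: R; apply: tpow_eq => [c u v|c u v|f].
- by rewrite tderiv_linear // teval_linear.
- by rewrite teval_linear scalerDr !scalerA mulrC.
rewrite tderivE // (lin_sum teval_linear) scaler_suml; apply: eq_bigr => l _.
rewrite !tevalE (bigD1 l) //= [in RHS](bigD1 l) //= ffunE eqxx rmorphM.
rewrite -mulrA -[RHS]/(_ * (_ * _)); congr (_ * (_ * _)).
by apply: eq_bigr => m ml; rewrite ffunE (negPf ml).
Qed.

Lemma tmap2_scale_deriv (a : A) (R : tpow n A) (t : tpow n (VA r A)) :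
  tmap2 (@VAscale K r A) (tderiv ( *%R a) R) t =
  tderiv (VAscale a) (tmap2 (@VAscale K r A) R t).
Proof.
have bs := @VAscale_bilin K r A.
have la : linear ( *%R a) := amul_linr a; have ls := @VAscale_linr K r A a.
move: R; apply: tpow_eq => [c u v|c u v|f].
- by rewrite tderiv_linear // (tmap2_linl bs).
- by rewrite (tmap2_linl bs) tderiv_linear.
move: t; apply: tpow_eq => [c u v|c u v|g].
- by rewrite (tmap2_linr bs).
- by rewrite (tmap2_linr bs) tderiv_linear.
rewrite (tmap2E bs) !tderivE // (lin_sum (tmap2_linl bs _)).
apply: eq_bigr => l _; rewrite (tmap2E bs); congr ptpow; apply/ffunP => m.
by rewrite !ffunE; case: eqP => // ->; rewrite VAscaleA.
Qed.

Lemma tmap2_scale1 (t : tpow n (VA r A)) :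
  tmap2 (@VAscale K r A) (ptpow [ffun=> 1]) t = t.
Proof.
have bs := @VAscale_bilin K r A; move: t; apply: tpow_eq => [c u v|c u v|g] //.
  by rewrite (tmap2_linr bs).
rewrite (tmap2E bs); congr ptpow; apply/ffunP => m.
by rewrite !ffunE VAscale1.
Qed.

Lemma teval1 : teval ev Z (ptpow [ffun=> 1]) = 1.
Proof. by rewrite tevalE big1 // => l _; rewrite ffunE rmorph1. Qed.

End Evaluation.

(** * Strings of sl_2 in integrable modules *)

Section Integrable.
Variables (K : fieldType) (r : nat) (A : comAlgType K) (W : curmod r A).
Hypothesis K0 : [pchar K] =i pred0.
Implicit Types (i j : 'I_r.+1) (y : W).

Lemma act_ptensZ c (x : sl K r) P y :
  act (ptens (c *: x) P) y = c *: act (ptens x P) y.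
Proof. by rewrite (linZ (ptens_linl _)) (linZ (act_linl _)). Qed.

Lemma act_slbr (x y : sl K r) P Q (w : W) :
  act (ptens x P) (act (ptens y Q) w) =
  act (ptens (slbr x y) (P * Q)) w + act (ptens y Q) (act (ptens x P) w).
Proof. by rewrite -curbrE act_br subrK. Qed.

Hypothesis intW : integrable W.

(** A Cartan element has finitely many eigenvalues on an integrable module; y
    need not be a weight vector for the whole Cartan subalgebra. *)
Lemma integrable_eigenvalues (h : sl K r) : cartan h ->
  exists s : seq K, forall c y,
    act (ptens h 1) y = c *: y -> y != 0 -> c \in s.
Proof.
move=> ch; have [D [uD [Dsum Ddir]]] := intW.
exists [seq weval mu h | mu <- D] => c y hy; apply: contraNT => cs.
have [f [wf def_y]] := Dsum y.
have: \sum_(mu <- D) (weval mu h - c) *: f mu = 0.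
  rewrite (eq_big_seq (fun mu => act (ptens h 1) (f mu) - c *: f mu)).
    by rewrite sumrB -scaler_sumr -(lin_sum (act_linr _)) -def_y hy subrr.
  by move=> mu muD; rewrite scalerBl wf.
move/Ddir=> f0; rewrite def_y big_seq big1 // => mu muD.
have /eqP : (weval mu h - c) *: f mu = 0.
  apply: f0 => // nu nuD h' ch'.
  by rewrite (linZ (act_linr _)) wf // !scalerA mulrC.
rewrite scaler_eq0 subr_eq0 => /orP[/eqP muc|/eqP//].
by case/negP: cs; rewrite -muc; apply: (map_f (fun nu => weval nu h)).
Qed.

Section String.
Variables (i j : 'I_r.+1) (ij : i != j).
Local Notation E := (act (ptens (elem K i j) (1 : A))).
Local Notation F := (act (ptens (elem K j i) (1 : A))).
Local Notation H := (act (ptens (hdiff K i j) (1 : A))).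
Variables (y : W) (c : K).
Hypotheses (Ey : E y = 0) (Hy : H y = c *: y).

Lemma sl2_weight m : H (iter m F y) = (c - m.*2%:R) *: iter m F y.
Proof.
elim: m => [|m IH]; first by rewrite subr0.
rewrite iterS act_slbr slbr_hdiff // mulr1 act_ptensZ IH (linZ (act_linr _)).
by rewrite -scalerDl doubleS -addn2 natrD; congr (_ *: _); ring.
Qed.

Lemma sl2_raise m : E (iter m.+1 F y) = (m.+1%:R * (c - m%:R)) *: iter m F y.
Proof.
elim: m => [|m IH].
  rewrite /= act_slbr slbr_elem // mulr1 Hy Ey (lin0 (act_linr _)).
  by rewrite addr0 subr0 mul1r.
rewrite iterS act_slbr slbr_elem // mulr1 sl2_weight IH (linZ (act_linr _)).
rewrite -iterS -scalerDl -muln2 natrM -!natr1; congr (_ *: _); ring.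
Qed.

End String.

(** In an integrable module a highest weight for sl_2 cannot be negative. *)
Lemma highest_weight_ge0 i j y k : i != j ->
  act (ptens (elem K i j) 1) y = 0 ->
  act (ptens (hdiff K i j) 1) y = - k.+1%:R *: y -> y = 0.
Proof.
move=> ij Ey Hy; have [s eig_s] := integrable_eigenvalues (cartan_hdiff K i j).
pose F := act (c := W) (ptens (elem K j i) 1).
have [/hasP[m _ Fm]|] :=
    boolP (has (fun m => iter m F y == 0) (iota 0 (size s).+1)); last first.
  (* Otherwise the strictly decreasing eigenvalues of the coroot along the
     string are more numerous than its possible eigenvalues. *)
  rewrite -all_predC => /allP nz.
  pose e m : K := - k.+1%:R - m.*2%:R.
  have inj_e : injective e.
    move=> m l /addrI/oppr_inj/eqP; rewrite -subr_eq0.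
    wlog lem : m l / (l <= m)%N.
      move=> wl; case/orP: (leq_total l m) => [/wl//|/wl wl' ml].
      by apply/esym/wl'; rewrite -opprB oppr_eq0.
    rewrite -natrB ?leq_double // -doubleB (pcharf0P K).1 // double_eq0.
    by rewrite subn_eq0 => ml; apply/eqP; rewrite eqn_leq ml.
  have: {subset [seq e m | m <- iota 0 (size s).+1] <= s}.
    move=> _ /mapP[m /nz mnz ->]; apply: eig_s mnz.
    exact: (sl2_weight ij Hy).
  move/(uniq_leq_size _); rewrite size_map size_iota ltnn.
  by rewrite (map_inj_uniq inj_e) iota_uniq => /(_ isT).
elim: m Fm => [/eqP//|m IH /eqP Fm]; apply: IH.
have := sl2_raise ij Ey Hy m; rewrite -/F Fm (lin0 (act_linr _)) => /esym/eqP.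
rewrite scaler_eq0 => /orP[|//]; rewrite -opprD -natrD mulrN oppr_eq0 -natrM.
by rewrite (pcharf0P K).1.
Qed.

(** The vector F^(n+1) y is again of highest weight, and its weight - n - 2 is
    negative. *)
Lemma highest_weight_string i j y n : i != j ->
  act (ptens (elem K i j) 1) y = 0 ->
  act (ptens (hdiff K i j) 1) y = n%:R *: y ->
  iter n.+1 (act (ptens (elem K j i) 1)) y = 0.
Proof.
move=> ij Ey Hy; apply: (@highest_weight_ge0 i j _ n.+1) => //.
  by rewrite (sl2_raise ij Ey Hy) subrr mulr0 scale0r.
(* The weight n - 2 (n + 1) is - (n + 2). *)
rewrite (sl2_weight ij Hy); congr (_ *: _).
rewrite -addnn natrD opprD addrA -[in X in X - _]natr1 opprD addrA subrr.
by rewrite -natr1; ring.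
Qed.
End Integrable.

(** * From symmetric tensors to a cyclic integrable module *)

Section Candidate.
Variables (K : fieldType) (r : nat) (A : comAlgType K).
Variables (M : Type) (ev : M -> {lrmorphism A -> K^o}).
Variables (n : nat) (Z : 'I_n -> M).
Hypothesis K0 : [pchar K] =i pred0.

Local Notation powersum := (@powersum K A M ev n Z).

Variables (W : curmod r A) (w : W).
Hypotheses (intW : integrable W) (weyl_w : weyl_vector ev Z w).
Implicit Types (i j : 'I_r.+1) (u v : VA r A) (a P : A) (X : cur r A).

Lemma npos_elem i j : (i < j)%N -> npos (elem K i j).
Proof.
move=> ij k l lk; rewrite /= mulmxnE mxE.
case: (k =P i) => [ki|_]; case: (l =P j) => [lj|_]; rewrite /= ?mul0rn //.
by rewrite ki lj leqNgt ij in lk.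
Qed.

Lemma weyl_elem i j P : (i < j)%N -> act (ptens (elem K i j) P) w = 0.
Proof. by case: weyl_w => w1 _ _ /npos_elem/w1. Qed.

Lemma weyl_hdiff0 j P : j != 0 ->
  act (ptens (hdiff K 0 j) P) w = powersum P *: w.
Proof.
case: weyl_w => _ w2 w3; case: (unliftP 0 j) => [k ->|->]; last by rewrite eqxx.
move=> _; rewrite -[lift 0 k]/(hi k).
case: k; elim=> [|m IH] mr.
  rewrite (_ : hdiff K 0 _ = coroot K (Ordinal mr)); first exact: w2.
  apply: val_inj => /=; congr (delta_mx _ _ - delta_mx _ _); exact: val_inj.
rewrite -(IH (ltnW mr)) (_ : hdiff K 0 _ =
   1 *: hdiff K 0 (hi (Ordinal (ltnW mr))) + coroot K (Ordinal mr)).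
  by rewrite ptens_linl act_linl w3 // addr0 scale1r.
apply: val_inj; rewrite /= scale1r.
rewrite (_ : hi (Ordinal (ltnW mr)) = lo (Ordinal mr)); last exact: val_inj.
by rewrite addrA subrK.
Qed.

Lemma weyl_hdiff i j P : i != 0 -> j != 0 ->
  act (ptens (hdiff K i j) P) w = 0.
Proof.
move=> i0 j0; rewrite hdiff_diff (linB (ptens_linl _)) (linB (act_linl _)).
by rewrite !weyl_hdiff0 // subrr.
Qed.

(** For 0 < i < j, the operator E_ji (x) P sends w to a vector of highest weight
    - 2 for the sl_2 of E_ij, hence to 0. *)
Lemma weyl_elem_levi i j P : i != 0 -> j != 0 ->
  act (ptens (elem K j i) P) w = 0.
Proof.
move=> i0 j0; case: (ltngtP i j) => [ij|/weyl_elem//|/val_inj->]; last first.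
  by rewrite elem0 (lin0 (ptens_linl _)) (lin0 (act_linl _)).
have ne : i != j by apply: contraTneq ij => ->; rewrite ltnn.
apply: (highest_weight_ge0 K0 intW (k := 1) ne).
  rewrite act_slbr slbr_elem // mul1r weyl_hdiff // weyl_elem //.
  by rewrite (lin0 (act_linr _)) addr0.
rewrite act_slbr slbr_hdiff // mul1r weyl_hdiff // (lin0 (act_linr _)) addr0.
by rewrite act_ptensZ.
Qed.

(** The power sum of u, acting on W: the part of u along e_1, ..., e_r acts by
    lowering operators, the part along e_0 by its value at the points. *)
Definition pact u (y : W) : W := act (lower u) y + powersum (coef 0 u) *: y.

Lemma pact_linl y : linear (pact^~ y).
Proof.
move=> c u v; rewrite /pact (lower_linear c u v) (act_linl y c).
rewrite (coef_linear 0 c u v) (powersum_linear ev Z c) scalerDl.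
by rewrite scalerDr !scalerA addrACA.
Qed.

Lemma pact_linr u : linear (pact u).
Proof.
move=> c x y; rewrite /pact (act_linr (lower u) c) !scalerDr !scalerA.
by rewrite [_ * c]mulrC addrACA.
Qed.

Lemma act_pact X u y :
  act X (pact u y) = pact u (act X y) + act (curbr X (lower u)) y.
Proof.
rewrite /pact (linD (act_linr X)) (linZ (act_linr X)) act_br [RHS]addrC.
by rewrite addrA subrK.
Qed.

Lemma pactC u v y : pact u (pact v y) = pact v (pact u y).
Proof.
rewrite {1}/pact act_pact lower_comm (lin0 (act_linl _)) addr0.
by rewrite -(linZ (pact_linr v)) -(linD (pact_linr v)).
Qed.

(** All the Weyl relations in one equation. *)
Lemma act_weyl X : act X w = pact (VAact X (vone r A)) w.
Proof.
elim/tens_ind: X => [|c x P X IH].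
  by rewrite (lin0 (act_linl _)) (lin0 (VAact_linl _)) (lin0 (pact_linl _)).
rewrite act_linl IH VAact_linl pact_linl; congr (_ *: _ + _) => {c X IH}.
rewrite VAact_vec mulr1 /pact (lin_sum (lower_linear (A:=A))).
rewrite (lin_sum (act_linl w)).
rewrite {1}[x]sl_decomp (linB (ptens_linl _)) !(lin_sum (ptens_linl _)).
rewrite (linB (act_linl w)) !(lin_sum (act_linl w)); congr (_ + _).
  apply: eq_bigr => i _; rewrite lower_vec (lin_sum (ptens_linl _)).
  rewrite (lin_sum (act_linl w)) (linZ (ptens_linr _)) (linZ (act_linl w)).
  rewrite (bigD1 0) //= act_ptensZ big1 ?addr0 // => j j0.
  rewrite act_ptensZ; case: (eqVneq i 0) => [->|i0].
    by rewrite weyl_elem ?scaler0 // lt0n.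
  by rewrite weyl_elem_levi ?scaler0.
have tr0 : x 0 0 = - \sum_(j | j != 0) x j j.
  apply/eqP; rewrite -addr_eq0; move: (slvalP x).
  by rewrite /traceless /mxtrace (bigD1 0).
rewrite (lin_sum (coef_linear 0)) [in RHS](bigD1 0) //=.
rewrite [X in _ = powersum (_ + X) *: _]big1; last first.
  by move=> j j0; rewrite coef_vec eq_sym (negPf j0).
rewrite coef_vec eqxx addr0 mulr1n (linZ (powersum_linear ev Z)) tr0 !scaleNr.
congr (- _).
rewrite (bigD1 0) //= act_ptensZ (_ : hdiff K 0 0 = 0); last first.
  by apply: val_inj; rewrite /= subrr.
rewrite (lin0 (ptens_linl _)) (lin0 (act_linl _)) scaler0 add0r !scaler_suml.
by apply: eq_bigr => j j0; rewrite act_ptensZ weyl_hdiff0 // scalerA.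
Qed.

Local Notation newton := (newton (@vmul K r A) pact w).

Lemma newton_act_cur X s : act X (newton s) =
  \sum_(z <- slotwise (VAact X) s) newton z + newton (VAact X (vone r A) :: s).
Proof.
exact: (@newton_act _ _ _ _ _ _ (@vmulC K r A) (@vmulCA K r A) pactC pact_linl
  pact_linr (@vmul_linl K r A) _ _ _ _ (fun X u => curbr X (lower u))
  (@act_linr _ _ _ W) (@vmul1 K r A) act_pact (@VAact_vmul K r A) act_weyl).
Qed.

Let nslot_lin := newton_slotlinear w (@vmulC K r A) (@vmulCA K r A) pactC
  pact_linl pact_linr (@vmul_linl K r A).
Let n_lin := newton_linear w (@vmulC K r A) (@vmulCA K r A) pactC
  pact_linl pact_linr (@vmul_linl K r A).
Let n_nseq := newton_slotwise_nseq w (@vmulC K r A) (@vmulCA K r A) pactC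
  pact_linr.

Lemma newton_lowest j m : j != 0 ->
  newton (nseq m (vec j 1)) = iter m (act (ptens (elem K j 0) 1)) w.
Proof.
move=> j0; elim: m => [|m IH]; first exact: newton_nil.
rewrite -[nseq m.+1 _]/(vec j 1 :: nseq m _) newton_cons.
rewrite -[nseq m _]cat0s n_nseq big_nil add0r cat0s IH.
rewrite vmul_vec (negPf j0) (lin0 (n_lin _)) mul0rn subr0.
rewrite /pact lower_vec coef_vec eq_sym (negPf j0).
by rewrite (lin0 (powersum_linear ev Z)) scale0r addr0.
Qed.

(** On sequences of size n + 1 the recursion gives 0: there are only n slots.
    The entries of the lowest vector, all equal to e_1 (x) 1, are replaced one
    by one. *)
Lemma newton_vanish s : (0 < r)%N -> size s = n.+1 -> newton s = 0.
Proof.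
move=> r0; pose j1 : 'I_r.+1 := lift 0 (Ordinal r0).
have j10 : j1 != 0 by [].
have nat0 q (y : W) : y *+ q.+1 = 0 -> y = 0.
  move/eqP; rewrite -scaler_nat scaler_eq0 (pcharf0P K).1 // => /eqP //.
suff V k us q : size us = k -> (k + q)%N = n.+1 ->
    newton (us ++ nseq q (vec j1 1)) = 0.
  by move=> sz; rewrite -[s]cats0; apply: (V _ s 0%N sz); rewrite addn0.
elim: k us q => [|k IH] us q.
  move/size0nil=> ->; rewrite add0n => ->; rewrite newton_lowest //.
  apply: (highest_weight_string K0 intW) => //.
    by rewrite weyl_elem.
  by rewrite weyl_hdiff0 // powersum1.
case: us => // u us [sz]; rewrite addSnnS => kq.
rewrite cat_cons.
have IHslot g :
    \sum_(z <- slotwise g us) newton (z ++ nseq q.+1 (vec j1 1)) = 0.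
  rewrite big_seq big1 // => z /size_slotwise zs.
  by apply: IH => //; rewrite zs.
have IHus := IH us q.+1 sz kq.
elim/VA_span: u => [|j a].
  split=> [|c x y Ex Ey]; first exact: (lin0 (n_lin _)).
  by rewrite (n_lin _ c x y) Ex Ey scaler0 addr0.
(* An operator sending vec j1 1 to vec j a is applied to the vanishing value
   at the sequence with one more entry vec j1 1. *)
have act0 X : act X (newton (us ++ nseq q.+1 (vec j1 1))) = 0.
  by rewrite IHus (lin0 (act_linr _)).
have nE X : newton (VAact X (vec j1 1) :: us ++ nseq q (vec j1 1)) *+ q.+1 =
    - newton (VAact X (vone r A) :: us ++ nseq q.+1 (vec j1 1)).
  apply/eqP; rewrite -addr_eq0 -(act0 X) newton_act_cur n_nseq IHslot.
  by rewrite add0r.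
case: (eqVneq j j1) => [->|jj1]; last first.
  apply: (nat0 q); have := nE (ptens (elem K j j1) a).
  rewrite !VAact_elem jj1 eqxx (negPf j10) mulr1 mulr0n.
  by rewrite (lin0 (n_lin _)) oppr0.
(* For j = j1 the operator E_11 - E_00 also moves the unit, to vec 0 (- a);
   by the recursion this extra entry multiplies the other entries, which
   doubles the wanted term instead of cancelling it. *)
have E : newton (vec 0 (- a) :: us ++ nseq q.+1 (vec j1 1)) =
         newton (vec j1 a :: us ++ nseq q (vec j1 1)) *+ q.+1.
  rewrite newton_cons IHus (lin0 (pact_linr _)) sub0r n_nseq IHslot add0r.
  rewrite vmul_vec eqxx mulr1 -mulNrn -scaleN1r -(linZ (n_lin _)).
  by rewrite -(linZ (vec_linear _)) scaleN1r opprK.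
have := nE (ptens (hdiff K j1 0) a); rewrite !VAact_hdiff !eqxx.
rewrite (negPf j10) [0 == j1]eq_sym (negPf j10) subr0 sub0r mulr1.
rewrite scale1r scaleN1r E => /eqP; rewrite -addr_eq0 -mulrnDr addnS => /eqP.
exact: nat0.
Qed.

(** The falling factorial counts the injections of m entries into n slots. *)
Lemma newton_one m : (m <= n)%N ->
  newton (nseq m (vone r A)) = (n ^_ m)%:R *: w.
Proof.
elim: m => [|m IH] mn; first by rewrite newton_nil ffactn0 scale1r.
rewrite -[nseq m.+1 _]/(_ :: nseq m _) newton_cons.
rewrite -[nseq m _]cat0s n_nseq big_nil add0r !cat0s vmul1 /pact.
rewrite lower_vec0 (lin0 (act_linl _)) add0r coef_vec powersum1.
have -> : newton (vone r A :: nseq m.-1 (vone r A)) *+ m =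
          newton (nseq m (vone r A)) *+ m by case: (m) => // k; rewrite !mulr0n.
rewrite -scaler_nat -scalerBl IH 1?ltnW // scalerA ffactnSr natrM.
by rewrite natrB 1?ltnW // mulrC.
Qed.

(** The map from the n-th tensor power of V (x) A to W; it sends the n-th power
    of e_0 (x) 1 to n! w, see weyl_map_one. *)
Definition weyl_map : tpow n (VA r A) -> W :=
  tpow_lift (fun f => newton [seq f l | l <- enum 'I_n]).

Lemma weyl_map_multilin : multilin (fun f : {ffun 'I_n -> VA r A} =>
  newton [seq f l | l <- enum 'I_n]).
Proof. exact/slotlinear_multilin/nslot_lin. Qed.

Lemma weyl_map_linear : linear weyl_map.
Proof. exact/tpow_lift_linear/weyl_map_multilin. Qed.

Lemma weyl_mapE f : weyl_map (ptpow f) = newton [seq f l | l <- enum 'I_n].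
Proof. exact/tpow_liftE/weyl_map_multilin. Qed.

Lemma weyl_map_deriv (D : VA r A -> VA r A) f : linear D ->
  weyl_map (tderiv D (ptpow f)) =
  \sum_(z <- slotwise D [seq f l | l <- enum 'I_n]) newton z.
Proof.
move=> lD; rewrite tderivE // (lin_sum weyl_map_linear).
rewrite slotwise_map ?enum_uniq // big_enum.
by apply: eq_bigr => l _; rewrite weyl_mapE.
Qed.

Hypothesis r0 : (0 < r)%N.

Lemma weyl_map_act X t : weyl_map (tderiv (VAact X) t) = act X (weyl_map t).
Proof.
have lX := VAact_linr X; move: t; apply: tpow_eq => [c u v|c u v|f].
- by rewrite tderiv_linear // weyl_map_linear.
- by rewrite weyl_map_linear act_linr.
rewrite weyl_map_deriv // weyl_mapE newton_act_cur newton_vanish ?addr0 //.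
by rewrite /= size_map size_enum_ord.
Qed.

Lemma weyl_map_scale a t :
  weyl_map (tderiv (VAscale a) t) = powersum a *: weyl_map t.
Proof.
have la := @VAscale_linr K r A a; move: t; apply: tpow_eq => [c u v|c u v|f].
- by rewrite tderiv_linear // weyl_map_linear.
- by rewrite weyl_map_linear scalerDr !scalerA mulrC.
rewrite weyl_map_deriv // weyl_mapE.
have := newton_vanish r0 (s := vec 0 a :: [seq f l | l <- enum 'I_n]).
rewrite /= size_map size_enum_ord newton_cons => /(_ erefl)/eqP.
rewrite subr_eq0 /pact lower_vec0 (lin0 (act_linl _)) add0r coef_vec eqxx.
by move/eqP->; rewrite (eq_slotwise _ (vmul_vec0 a)).
Qed.

Lemma weyl_map_one : weyl_map (ptpow [ffun=> vone r A]) = n`!%:R *: w.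
Proof.
rewrite weyl_mapE -ffactnn -newton_one //; congr newton.
rewrite -[n in nseq n]size_enum_ord; elim: (enum 'I_n) => //= l s ->.
by rewrite ffunE.
Qed.

(** Symmetric functions act on W through their value at the points. *)
Lemma weyl_map_tmap2 (R : sympow n A) (t : tpow n (VA r A)) :
  weyl_map (tmap2 (@VAscale K r A) R t) = teval ev Z R *: weyl_map t.
Proof.
have bs := @VAscale_bilin K r A.
pose Q (R : tpow n A) := forall t,
  weyl_map (tmap2 (@VAscale K r A) R t) = teval ev Z R *: weyl_map t.
have sQ : subspace Q.
  split=> [u|c R1 R2 Q1 Q2 u].
    rewrite (lin0 (tmap2_linl bs _)) (lin0 weyl_map_linear).
    by rewrite (lin0 (teval_linear ev Z)) scale0r.
  rewrite (tmap2_linl bs) weyl_map_linear Q1 Q2 (teval_linear ev Z).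
  by rewrite scalerDl scalerA.
suff : Q R by apply.
apply: (symmetric_span K0 sQ) => f.
apply: (symprod_ind K0 (one := 1) (mul := *%R) (@mulr1 A) _ sQ).
- by move=> s g; apply: symprod_perm.
- move=> u; rewrite symprod_const (linZ (tmap2_linl bs _)) tmap2_scale1.
  rewrite (linZ weyl_map_linear) (linZ (teval_linear ev Z)) teval1.
  by rewrite -[X in _ = X *: _]/(_ * 1) mulr1.
- move=> a g Qg u; rewrite -(tderiv_symprod g (amul_linr a)).
  rewrite tmap2_scale_deriv weyl_map_scale Qg teval_deriv.
  by rewrite scalerA.
Qed.
End Candidate.

(** * Weight decompositions *)

Section Weights.
Variables (K : fieldType) (r : nat) (A : comAlgType K) (W : curmod r A).
Hypothesis K0 : [pchar K] =i pred0.

Lemma intr_eq0_char0 (m : int) : (m%:~R == 0 :> K) = (m == 0).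
Proof.
case: m => m; first by rewrite -pmulrn (pcharf0P K).1.
by rewrite NegzE mulrNz oppr_eq0 -pmulrn (pcharf0P K).1.
Qed.

Lemma weight_subspace (mu : weight r) : subspace (@weight_space K r A W mu).
Proof.
split=> [h ch|c u v wu wv h ch]; first by rewrite (lin0 (act_linr _)) scaler0.
by rewrite act_linr wu // wv // scalerDr !scalerA mulrC.
Qed.

(** Weight spaces for distinct weights are independent. *)
Lemma weight_direct (D : seq (weight r)) (f : weight r -> W) : uniq D ->
  (forall mu, mu \in D -> weight_space mu (f mu)) ->
  \sum_(mu <- D) f mu = 0 -> forall mu, mu \in D -> f mu = 0.
Proof.
elim: D f => [|nu D IH] f //= /andP[nuD uD] wf sum0.
have wD mu : mu \in D -> weight_space mu (f mu).
  by move=> muD; apply: wf; rewrite inE muD orbT.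
(* Applying the i-th simple coroot minus its value on nu removes f nu. *)
have fD mu : mu \in D -> f mu = 0.
  move=> muD; have [i ne_i] : exists i, mu i != nu i.
    apply/existsP; rewrite -[[exists _, _]]negbK negb_exists.
    apply: contra nuD => /forallP eq_mu; rewrite (_ : nu = mu) //.
    by apply/ffunP => i; apply/esym/eqP; have := eq_mu i; rewrite negbK.
  have /eqP : ((mu i)%:~R - (nu i)%:~R : K) *: f mu = 0.
    apply: (IH (fun mu => ((mu i)%:~R - (nu i)%:~R : K) *: f mu)) => //.
      by move=> la laD; apply: (subspaceZ (weight_subspace la)); apply: wD.
    have ci : cartan (coroot K i).
      have -> : coroot K i = hdiff K (lo i) (hi i) by apply: val_inj.
      exact: cartan_hdiff.
    have wE la : la \in nu :: D ->
        act (ptens (coroot K i) 1) (f la) = (la i)%:~R *: f la.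
      by move=> /wf/(_ _ ci)->; rewrite weval_coroot.
    have: act (ptens (coroot K i) 1) (\sum_(la <- nu :: D) f la) -
          (nu i)%:~R *: \sum_(la <- nu :: D) f la = 0.
      by rewrite sum0 (lin0 (act_linr _)) scaler0 subrr.
    rewrite (lin_sum (act_linr _)) scaler_sumr -sumrB big_cons.
    rewrite wE ?mem_head // subrr add0r => E; rewrite -[RHS]E.
    apply: eq_big_seq => la laD.
    by rewrite scalerBl wE // inE laD orbT.
  rewrite scaler_eq0 -rmorphB intr_eq0_char0 subr_eq0 (negPf ne_i) /=.
  by move/eqP.
move=> mu; rewrite inE => /predU1P[->|/fD//].
by move: sum0; rewrite big_cons big_seq big1 ?addr0.
Qed.

(** The vector y is a sum of weight vectors with weights in D. *)
Definition weight_sum (D : seq (weight r)) (y : W) :=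
  exists f : weight r -> W,
    (forall mu, mu \in D -> weight_space mu (f mu)) /\ y = \sum_(mu <- D) f mu.

Lemma weight_sum_subspace D : subspace (weight_sum D).
Proof.
split=> [|c u v [f [wf ->]] [g [wg ->]]].
  exists (fun=> 0); split; last by rewrite big1.
  by move=> mu _; apply: (weight_subspace mu).1.
exists (fun mu => c *: f mu + g mu); split.
  by move=> mu muD; apply: (weight_subspace mu).2; auto.
by rewrite big_split scaler_sumr.
Qed.

Lemma weight_sum_mem (D : seq (weight r)) mu y :
  uniq D -> mu \in D -> weight_space mu y -> weight_sum D y.
Proof.
move=> uD muD wy; exists (fun la => if la == mu then y else 0); split.
  by move=> la _; case: eqP => [->//|_]; apply: (weight_subspace la).1.
rewrite (bigD1_seq mu) //= eqxx big1 ?addr0 // => la.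
by case: eqP.
Qed.

Lemma weight_sum_integrable D :
  uniq D -> (forall y, weight_sum D y) -> integrable W.
Proof.
by move=> uD sD; exists D; split=> //; split=> // f; apply: weight_direct.
Qed.

(** The weight of the basis vector e_k of the vector representation. *)
Definition vweight (k : 'I_r.+1) : weight r :=
  [ffun i => (k == lo i)%:Z - (k == hi i)%:Z].

Lemma weval_vweight k (h : sl K r) : weval (vweight k) h = h k k.
Proof.
have tr0 : \sum_m h m m = 0 by apply/eqP: (slvalP h).
pose S (i : 'I_r) : K := \sum_(m < r.+1 | (m <= i)%N) h m m.
have pick (j : 'I_r -> 'I_r.+1) (i : 'I_r) : injective j ->
    \sum_i' (j i == j i')%:R * S i' = S i.
  move=> inj_j; rewrite (bigD1 i) //= eqxx mul1r big1 ?addr0 // => i' ne.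
  by rewrite (inj_eq inj_j) eq_sym (negPf ne) mul0r.
have Slo : \sum_i (k == lo i)%:R * S i = \sum_(m < r.+1 | (m <= k)%N) h m m.
  case: (unliftP ord_max k) => [i def_k|->].
    have -> : k = lo i by rewrite def_k; apply: val_inj; exact: lift_max.
    by rewrite pick // => x y /(congr1 val)/= /val_inj.
  rewrite big1 => [|i _]; last first.
    by rewrite -val_eqE /= gtn_eqF ?mul0r.
  by rewrite -[LHS]tr0; apply: eq_bigl => m; rewrite -ltnS ltn_ord.
have Shi : \sum_i (k == hi i)%:R * S i = \sum_(m < r.+1 | (m < k)%N) h m m.
  case: (unliftP 0 k) => [i ->|->]; last first.
    by rewrite big1 ?big_pred0 // => i _; rewrite mul0r.
  by rewrite (pick (@hi r)) //; apply: lift_inj.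
rewrite /weval.
rewrite (eq_bigr (fun i => (k == lo i)%:R * S i - (k == hi i)%:R * S i)).
  rewrite sumrB Slo Shi (bigD1 k) //= (eq_bigl (fun m : 'I_r.+1 => (m < k)%N)).
    by rewrite addrK.
  by move=> m; rewrite ltn_neqAle andbC.
by move=> i _; rewrite ffunE rmorphB /= -!pmulrn mulrBl.
Qed.

End Weights.

(** * The quotient of the symmetric power is the local Weyl module *)

Section SymmetricQuotient.
Variables (K : fieldType) (r : nat) (A : comAlgType K).
Variables (M : Type) (ev : M -> {lrmorphism A -> K^o}).
Variables (n : nat) (Z : 'I_n -> M).
Hypothesis K0 : [pchar K] =i pred0.

Local Notation VA := (VA r A).
Local Notation SQ := (sym_quotient r ev Z).
Local Notation sv := (sym_vector r ev Z).
Local Notation JS := (@JS K r A M ev n Z).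
Local Notation powersum := (@powersum K A M ev n Z).

Lemma symderiv_sym (V : lmodType K) (D : V -> V) (lD : linear D)
    (t : sympow n V) : symmetric_tensor (tderiv D t).
Proof.
by apply/symmetric_tensorP => s; rewrite tderiv_shuffle // sympow_fix.
Qed.

(** The derivation of the symmetric power induced by a linear operator. *)
Definition symderiv (V : lmodType K) (D : V -> V) (lD : linear D)
    (t : sympow n V) : sympow n V := Sympow (symderiv_sym lD t).

(** In the quotient the power sum of a acts by its value at the points. *)
Lemma proj_scale (a : A) (t t' : sympow n VA) :
  symval t' = tderiv (VAscale a) t -> proj JS t' = powersum a *: proj JS t.
Proof.
move=> def_t'; rewrite -projZ; apply/eq_proj/span_gen.
pose one := symconst n (1 : A).
exists (symderiv (amul_linr a) one - powersum a *: one), t; split.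
  rewrite /J /= (linB (teval_linear ev Z)) (linZ (teval_linear ev Z)).
  by rewrite teval_deriv subrr.
have bs := @VAscale_bilin K r A.
apply: val_inj; rewrite /= def_t' (linB (tmap2_linl bs _)).
by rewrite (linZ (tmap2_linl bs _)) tmap2_scale_deriv tmap2_scale1.
Qed.

Lemma act_proj (X : cur r A) (t : sympow n VA) :
  act (c := SQ) X (proj JS t) = proj JS (symact (W := VAmod r A) X t).
Proof.
exact: (qactE (W := symmod n (VAmod r A)) (@JS_stable K r A M ev n Z)).
Qed.

Lemma act_sym_vector (X : cur r A) (a : A) :
  VAact X (vone r A) = vec 0 a -> act X sv = powersum a *: sv.
Proof.
move=> Xv; rewrite /sym_vector act_proj; apply: proj_scale => /=.
rewrite !tderivE; [|exact: VAscale_linr|exact: VAact_linr].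
apply: eq_bigr => l _; congr (ptpow (upd _ _ _)).
by rewrite !ffunE -[ptens _ _]/(vone r A) Xv VAscale_vec mulr1.
Qed.

Lemma coroot_column (i : 'I_r) (k : 'I_r.+1) :
  coroot K i k 0 = ((k == 0) && (i == 0 :> nat))%:R.
Proof.
rewrite !mxE (_ : (0 == hi i) = false) // andbF subr0; congr (nat_of_bool _)%:R.
have -> : (0 == lo i) = (i == 0 :> nat) by rewrite -val_eqE /= eq_sym.
case: (i =P 0 :> nat) => [i0|_]; last by rewrite !andbF.
by rewrite (_ : lo i = 0) //; apply: val_inj.
Qed.

Lemma sym_vector_weyl : weyl_vector ev Z sv.
Proof.
have ps0 : powersum 0 = 0 := lin0 (powersum_linear ev Z).
split=> [x P np|i P i0|i P i0].
- rewrite (act_sym_vector (a := 0)) ?ps0 ?scale0r // VAact_vec vec0.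
  by rewrite big1 // => i _; rewrite np // scale0r vec0.
- apply: act_sym_vector; rewrite VAact_vec (bigD1 0) //= big1 => [|k k0].
    by rewrite coroot_column i0 scale1r mulr1 addr0.
  by rewrite coroot_column (negPf k0) scale0r vec0.
rewrite (act_sym_vector (a := 0)) ?ps0 ?scale0r // VAact_vec vec0.
by rewrite big1 // => k _; rewrite coroot_column (gtn_eqF i0) andbF scale0r vec0.
Qed.

(** The tensor t is symmetric and its class in the quotient satisfies P. *)
Definition sympred (P : SQ -> Prop) (t : tpow n VA) :=
  exists2 t' : sympow n VA, symval t' = t & P (proj JS t').

Lemma sympred_subspace P : subspace P -> subspace (sympred P).
Proof.
move=> sP; split=> [|c u v [t <- Pt] [t' <- Pt']].
  by exists 0 => //; rewrite raddf0; apply: sP.1.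
by exists (c *: t + t') => //; rewrite projD projZ; apply: sP.2.
Qed.

Lemma sym_quotient_span (P : SQ -> Prop) : subspace P ->
  (forall f, sympred P (symprod f)) -> forall q, P q.
Proof.
move=> sP PG q; rewrite -[q]qreprK.
have [t /val_inj-> //] :=
  symmetric_span K0 (sympred_subspace sP) PG (qrepr q).
Qed.

Lemma sym_vector_generates : generated_by sv.
Proof.
move=> U Uv Ulin Uact.
have sU : subspace U.
  by split=> //; rewrite -(addNr sv) -scaleN1r; apply: Ulin.
apply: (sym_quotient_span sU).
apply: (symprod_ind K0 (one := vone r A) (mul := @vmul K r A)
  (@vmul1 K r A) _ (sympred_subspace sU)).
- by move=> s g; apply: symprod_perm.
- exists (n`!%:R *: symconst n (vone r A)); first by rewrite symprod_const.
  by rewrite projZ; apply: (subspaceZ sU).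
move=> u f [t def_t Ut].
rewrite -(tderiv_symprod f (vmul_linr u)) -def_t.
(* The power sum of u is a lowering operator plus the power sum of the
   coefficient of e_0, which is a scalar in the quotient. *)
exists (symact (W := VAmod r A) (lower u) t +
        symderiv (@VAscale_linr K r A (coef 0 u)) t).
  rewrite [RHS](tderiv_lin (a := 1) (D := VAact (lower u))
                           (E := VAscale (coef 0 u))).
  - by rewrite scale1r.
  - exact: VAact_linr.
  - exact: VAscale_linr.
  - exact: vmul_linr.
  - by move=> v; rewrite scale1r.
rewrite projD (proj_scale (t' := symderiv _ _) (erefl _)) addrC.
apply: (sU.2 _ _ _ Ut); have := Uact (lower u) _ Ut.
by rewrite act_proj.
Qed.

Lemma symprod_multilin (V : lmodType K) : multilin (@symprod K n V).
Proof.
move=> f l c u v; rewrite /symprod scaler_sumr -big_split.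
apply: eq_bigr => s _; exact: tshuffle_multilin.
Qed.

(** By multilinearity, basis vectors of V suffice in the slots. *)
Lemma symprod_vec_ind (Q : tpow n VA -> Prop) : subspace Q ->
  (forall k a, Q (symprod [ffun l => vec (k l) (a l)])) ->
  forall f, Q (symprod f).
Proof.
move=> sQ Qvec f; suff: forall (e : seq 'I_n) (f : {ffun 'I_n -> VA}),
    (* The slots in e have not been expanded yet. *)
    (forall l, l \notin e -> exists ka, f l = vec ka.1 ka.2) -> Q (symprod f).
  by move/(_ (enum 'I_n)); apply=> l; rewrite mem_enum.
elim=> [|l e IH] {}f fv.
  have [ka def_f] := fin_all_exists (fun l => fv l isT).
  rewrite (_ : f = [ffun l => vec (ka l).1 (ka l).2]); first exact: Qvec.
  by apply/ffunP => l; rewrite ffunE.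
have -> : f = upd f l (f l).
  by apply/ffunP => m; rewrite ffunE; case: eqP => [->|].
elim/VA_span: (f l) => [|k a].
  have ml := @symprod_multilin VA f l.
  split; first by rewrite (lin0 ml); apply: sQ.1.
  by move=> c u v Qu Qv; rewrite ml; apply: sQ.2.
apply: IH => m me; rewrite ffunE; case: eqP => [_|/eqP ml].
  by exists (k, a).
by apply: fv; rewrite inE (negPf ml).
Qed.

Lemma sym_quotient_integrable : integrable SQ.
Proof.
pose wt (k : {ffun 'I_n -> 'I_r.+1}) : weight r := \sum_l vweight (k l).
apply: (@weight_sum_integrable _ _ _ _ K0 (undup (codom wt))).
  exact: undup_uniq.
have sP := weight_sum_subspace SQ (undup (codom wt)).
apply: (sym_quotient_span sP) => f.
apply: symprod_vec_ind; first exact: sympred_subspace.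
move=> k a {f}; set f := finfun _.
exists (Sympow (symprod_sym f)) => //.
apply: (@weight_sum_mem _ _ _ _ _ (wt [ffun l => k l])).
- exact: undup_uniq.
- by rewrite mem_undup codom_f.
move=> h ch; rewrite act_proj -projZ; congr proj; apply: val_inj => /=.
rewrite tderiv_symprod; last exact: VAact_linr.
have hv l : VAact (ptens h 1) (f l) = h (k l) (k l) *: f l.
  rewrite ffunE VAact_vec (bigD1 (k l)) //= big1 ?addr0 => [|m mk].
    by rewrite mul1r (linZ (vec_linear _)).
  by move/is_diag_mxP: ch => -> //; rewrite scale0r vec0.
under eq_bigr do rewrite hv (linZ (@symprod_multilin VA f _)).
rewrite (eq_bigr (fun l => h (k l) (k l) *: symprod f)) => [|l _]; last first.
  congr (_ *: symprod _); apply/ffunP => m; rewrite ffunE.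
  by case: eqP => [->|].
rewrite -scaler_suml; congr (_ *: _).
rewrite (eq_bigr (fun l => weval (vweight (k l)) h)) => [|l _]; last first.
  by rewrite weval_vweight.
rewrite /weval exchange_big; apply: eq_bigr => i _.
rewrite -mulr_suml; congr (_ * _).
rewrite /wt sum_ffunE rmorph_sum /=; apply: eq_bigr => l _.
by congr ((vweight _ i)%:~R); rewrite ffunE.
Qed.

Lemma sym_quotient_candidate : weyl_candidate ev Z sv.
Proof.
by split; [exact: sym_quotient_integrable | exact: sym_vector_generates
          | exact: sym_vector_weyl].
Qed.

Lemma sym_quotient_maximal (W : curmod r A) (w : W) : (0 < r)%N ->
  weyl_candidate ev Z w ->
  exists f : {linear SQ -> W},
    [/\ equivariant f, f sv = w & forall y, exists x, f x = y].
Proof.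
move=> r0 [intW gen_w weyl_w].
pose g (t : sympow n VA) : W := (n`!%:R)^-1 *: weyl_map ev Z w t.
have lwm := weyl_map_linear ev Z w.
have lg : linear g.
  by move=> c u v; rewrite /g /= lwm scalerDr !scalerA mulrC.
have g0 t : JS t -> g t = 0.
  case=> R [u [JR ->]]; rewrite /g /= (weyl_map_tmap2 K0 intW weyl_w r0).
  by rewrite JR scale0r scaler0.
have lq : linear (qlift g : SQ -> W) := qlift_linear lg g0.
pose f : {linear SQ -> W} := HB.pack (qlift g : SQ -> W)
   (GRing.isLinear.Build K SQ W _ (qlift g : SQ -> W) lq).
have fE t : f (proj JS t) = g t by exact: (qliftE lg g0).
have eqf : equivariant f.
  move=> X q; rewrite -[q]qreprK act_proj !fE /g /= (linZ (act_linr X)).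
  by rewrite (weyl_map_act K0 intW weyl_w r0).
have fv : f sv = w.
  rewrite fE /g /= -[X in ptpow X]/[ffun=> vone r A] weyl_map_one //.
  by rewrite scalerA mulVf ?scale1r // natr_neq0 // fact_gt0.
exists f; split=> //; apply: gen_w; first by exists sv.
  by move=> c _ _ [x <-] [y <-]; exists (c *: x + y); rewrite linearP.
by move=> X _ [x <-]; exists (act X x).
Qed.

Lemma sym_quotient_local_weyl : (0 < r)%N -> is_local_weyl ev Z sv.
Proof.
move=> r0; split=> [|W w]; first exact: sym_quotient_candidate.
exact: sym_quotient_maximal.
Qed.

Lemma generated_id (W : curmod r A) (w : W) (f : W -> W) : linear f ->
  equivariant f -> generated_by w -> f w = w -> forall y, f y = y.
Proof.
move=> lf ef gen_w fw; apply: gen_w => // [c u v fu fv|X u fu].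
  by rewrite lf fu fv.
by rewrite ef fu.
Qed.

Lemma local_weyl_unique (W W' : curmod r A) (w : W) (w' : W') :
  is_local_weyl ev Z w -> is_local_weyl ev Z w' ->
  exists f : {linear W -> W'}, [/\ equivariant f, bijective f & f w = w'].
Proof.
case=> cw maxW [cw' maxW']; have [f [ef fw _]] := maxW _ _ cw'.
have [g [eg gw _]] := maxW' _ _ cw; exists f; split=> //; exists g.
  case: cw => _ gen_w _; apply: (generated_id (f := g \o f)) gen_w _ => //=.
  - by move=> c u v; rewrite /= !linearP.
  - by move=> X u; rewrite /= ef eg.
  - by rewrite fw.
case: cw' => _ gen_w' _; apply: (generated_id (f := f \o g)) gen_w' _ => //=.
- by move=> c u v; rewrite /= !linearP.
- by move=> X u; rewrite /= eg ef.
- by rewrite gw.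
Qed.

End SymmetricQuotient.

Theorem theorem7 (R : realType) (M : Type) (A : comAlgType R[i])
    (ev : M -> {lrmorphism A -> R[i]^o}) (r n : nat) (Z : 'I_n -> M) :
  affine_variety ev -> (1 <= r)%N ->
  (exists (W : curmod r A) (w : W), is_local_weyl ev Z w) /\
  (forall (W : curmod r A) (w : W), is_local_weyl ev Z w ->
     exists f : {linear W -> sym_quotient r ev Z},
       [/\ equivariant f, bijective f & f w = sym_vector r ev Z]).
Proof.
move=> _ r0.
have SQ := sym_quotient_local_weyl ev Z (@Num.Theory.pchar_num _) r0.
split; first by exists (sym_quotient r ev Z), (sym_vector r ev Z).
by move=> W w /local_weyl_unique; apply.
Qed.
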